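(* Suppose $(\tau_1,\ldots,\tau_m)$ satisfies the density hypothesis with respect to $\mathcal{F}_\infty$: there exist a Borel probability measure $\mu$ on $[0,\infty]$ and a nonnegative $\mathcal{B}[0,\infty]^m\otimes\mathcal{F}_\infty$-measurable function $\gamma$ on $[0,\infty]^m\times\Omega$ such that $\mathbb{Q}[(\tau_1,\ldots,\tau_m)\in A\mid\mathcal{F}_\infty]=\int_A\gamma(t_1,\ldots,t_m)\,\mu^{\otimes m}(dt_1,\ldots,dt_m)$ for all $A\in\mathcal{B}[0,\infty]^m$. Then the $\mathbb{G}^m$-optional splitting formula holds at times $\tau_1,\ldots,\tau_m$ with respect to $\mathbb{F}$.
   Context: Let $(\Omega,\mathcal{A},\mathbb{Q})$ be a probability space with a right-continuous filtration $\mathbb{F}=(\mathcal{F}_t)_{t\ge0}$ such that $\mathcal{F}_0$ contains $\mathcal{N}^{\mathcal{F}_\infty}$, where for a $\sigma$-algebra $\mathcal{T}\subset\mathcal{A}$, $\mathcal{N}^{\mathcal{T}}$ denotes the $\sigma$-algebra generated by all subsets of $\mathcal{T}$-measurable $\mathbb{Q}$-null sets. Let $\tau_1,\ldots,\tau_m$ be $[0,\infty]$-valued random variables. Set $\mathbb{G}^0=\mathbb{F}$ and for $1\le k\le m$, $\mathcal{N}^k=\mathcal{N}^{\sigma(\tau_1)\vee\cdots\vee\sigma(\tau_k)\vee\mathcal{F}_\infty}$ and $\mathcal{G}^k_t=\mathcal{N}^k\vee\bigcap_{s>t}(\mathcal{G}^{k-1}_s\vee\sigma(\tau_k\wedge s))$.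 $\sigma_{m,1}\le\cdots\le\sigma_{m,m}$ denotes the increasing reordering of $\tau_1,\ldots,\tau_m$, with $\sigma_{m,0}=0$, $\sigma_{m,m+1}=\infty$. For $a,b\in[0,\infty]$, $a\nmid b=a$ if $a\le b$ and $=\infty$ if $a>b$. The $\mathbb{G}^m$-optional splitting formula holds at times $\tau_1,\ldots,\tau_m$ with respect to $\mathbb{F}$ if for every $\mathbb{G}^m$-optional $Y$ there exist $\mathcal{B}[0,\infty]^m\otimes\mathcal{O}(\mathbb{F})$-measurable functions $Y^{(0)},\ldots,Y^{(m)}$ on $[0,\infty]^m\times(\mathbb{R}_+\times\Omega)$ with $Y=\sum_{i=0}^mY^{(i)}(\tau_1\nmid\sigma_{m,i},\ldots,\tau_m\nmid\sigma_{m,i})\mathbf{1}_{[\sigma_{m,i},\sigma_{m,i+1})}$ up to indistinguishability outside an $\mathcal{N}^m$-measurable null set, where $Y^{(i)}(\Upsilon)(t,\omega)=Y^{(i)}(\Upsilon(\omega),t,\omega)$. *)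

(* Defs.v *)
From HB Require Import structures.
From mathcomp Require Import all_boot all_order all_algebra.
From mathcomp Require Import all_classical all_reals all_analysis.
From mathcomp Require Import measurable_realfun.
Unset Printing Implicit Defensive.
Import Order.TTheory GRing.Theory Num.Theory.
Import numFieldNormedType.Exports.
Local Open Scope classical_set_scope.
Local Open Scope ring_scope.

Section Defs.
Context {d : measure_display} {Omega : measurableType d} {R : realType}.
Variable Q : probability Omega R.

Definition sigma_of {d' : measure_display} {T : measurableType d'}
  (X : Omega -> T) : set (set Omega) :=
  [set X @^-1` B | B in [set B | measurable B]].

Definition nullsig (T : set (set Omega)) : set (set Omega) :=
  <<s [set N | exists M, T M /\ measurable M /\ Q M = 0%E /\ N `<=` M] >>.

Definition Finfty (F : R -> set (set Omega)) : set (set Omega) :=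
  <<s [set A | exists t, 0 <= t /\ F t A] >>.

Definition join2 (S1 S2 : set (set Omega)) : set (set Omega) := <<s S1 `|` S2 >>.

(* the tau's are indexed 0..m-1 : tau 0 = tau_1, ..., tau (m-1) = tau_m *)
Definition Nk (F : R -> set (set Omega)) (tau : nat -> Omega -> \bar R) (k : nat)
  : set (set Omega) :=
  nullsig (<<s Finfty F `|` [set A | exists2 j, (j < k)%N & sigma_of (tau j) A] >>).

Fixpoint Gk (F : R -> set (set Omega)) (tau : nat -> Omega -> \bar R) (k : nat)
  : R -> set (set Omega) :=
  match k with
  | 0%N => F
  | k'.+1 => fun t =>
      join2 (Nk F tau k)
        [set A | forall s, t < s ->
           join2 (Gk F tau k' s) (sigma_of (fun w => Order.min (tau k' w) s%:E)) A]
  end.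

Definition Dplus : set (R * Omega) := [set p | 0 <= p.1].

Definition cadlag_adapted (H : R -> set (set Omega)) (X : R -> Omega -> R) : Prop :=
  (forall t, 0 <= t -> forall B : set R, measurable B -> H t (X t @^-1` B)) /\
  (forall w t, 0 <= t -> (fun s => X s w) @ t^'+ --> X t w) /\
  (forall w t, 0 < t -> cvg ((fun s => X s w) @ t^'-)).

Definition optional (H : R -> set (set Omega)) : set (set (R * Omega)) :=
  <<s Dplus, [set A | exists (X : R -> Omega -> R) (B : set R),
      [/\ cadlag_adapted H X, measurable B & A = Dplus `&` [set p | B (X p.1 p.2)]]] >>.

Definition nonnegvec (m : nat) : set ('I_m -> \bar R) := [set v | forall j, (0 <= v j)%E].

Definition Bm (m : nat) : set (set ('I_m -> \bar R)) :=
  <<s nonnegvec m, [set A | exists (j : 'I_m) (B : set (\bar R)),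
      measurable B /\ A = nonnegvec m `&` [set v | B (v j)]] >>.

Definition prod_sig {X : Type} (m : nat) (D : set X) (S : set (set X))
  : set (set (('I_m -> \bar R) * X)) :=
  <<s nonnegvec m `*` D, [set A `*` C | A in Bm m & C in S] >>.

Definition measurable_wrt {X : Type} (D : set X) (S : set (set X)) (f : X -> R) : Prop :=
  forall B : set R, measurable B -> S (D `&` f @^-1` B).

Definition sigma_os (m : nat) (tau : nat -> Omega -> \bar R) (i : nat) (w : Omega)
  : \bar R :=
  if i == 0%N then 0%E
  else if (m < i)%N then +oo%E
  else nth 0%E (sort (fun x y : \bar R => (x <= y)%E) [seq tau j w | j <- iota 0 m]) i.-1.

Definition nmid (a b : \bar R) : \bar R := if (a <= b)%E then a else +oo%E.

(* integral over [0,oo]^m w.r.t. mu^{(x) m}, computed as an iterated integral *)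
Definition setc (m : nat) (v : 'I_m -> \bar R) (j : 'I_m) (x : \bar R) : 'I_m -> \bar R :=
  fun k => if k == j then x else v k.

Fixpoint iter_int (m : nat) (mu : {measure set \bar R -> \bar R}) (l : seq 'I_m)
  (f : ('I_m -> \bar R) -> \bar R) (v : 'I_m -> \bar R) : \bar R :=
  match l with
  | [::] => f v
  | j :: l' => (\int[mu]_x iter_int m mu l' f (setc m v j x))%E
  end.

Definition prod_int (m : nat) (mu : {measure set \bar R -> \bar R})
  (f : ('I_m -> \bar R) -> \bar R) : \bar R :=
  iter_int m mu (enum 'I_m) f (fun _ => 0%E).

Definition density_hyp (F : R -> set (set Omega)) (m : nat)
  (tau : nat -> Omega -> \bar R) : Prop :=
  exists (mu : probability (\bar R) R) (gamma : ('I_m -> \bar R) * Omega -> R),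
    [/\ mu (~` [set x | (0 <= x)%E]) = 0%E,
        (forall p, 0 <= gamma p),
        measurable_wrt (nonnegvec m `*` setT) (prod_sig m setT (Finfty F)) gamma &
        forall A, Bm m A -> A `<=` nonnegvec m -> forall B, Finfty F B ->
          Q (B `&` [set w | A (fun j : 'I_m => tau j w)]) =
          (\int[Q]_(w in B)
             prod_int m mu (fun v => (\1_A v)%:E * (gamma (v, w))%:E))%E].

Definition optional_splitting (F : R -> set (set Omega)) (m : nat)
  (tau : nat -> Omega -> \bar R) : Prop :=
  forall Y : R * Omega -> R, measurable_wrt Dplus (optional (Gk F tau m)) Y ->
  exists Ys : 'I_m.+1 -> ('I_m -> \bar R) * (R * Omega) -> R,
    (forall i, measurable_wrt (nonnegvec m `*` Dplus) (prod_sig m Dplus (optional F)) (Ys i)) /\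
    exists N : set Omega,
      [/\ Nk F tau m N,
          (exists M, [/\ measurable M, Q M = 0%E & N `<=` M]) &
          forall w, ~ N w -> forall t : R, 0 <= t ->
            Y (t, w) = \sum_(i < m.+1)
              Ys i (fun j : 'I_m => nmid (tau j w) (sigma_os m tau i w), (t, w)) *
              (if ((sigma_os m tau i w <= t%:E)%E && (t%:E < sigma_os m tau i.+1 w)%E)
               then 1 else 0)].
End Defs.

(* Main.v *)
(** By the density hypothesis the law of [(tau, w)] on [[0, oo]^m x Omega] is absolutely
    continuous with respect to [mu^m (x) Q], so that statements which hold almost
    everywhere on the product space pull back to [Omega].

    Events of [G^m_t] are, up to null sets, pulled back from events of the product space
    which for every [s > t] belong to [B^m (x) F_s] and depend on [v] only through
    [v /\ s]. Optional processes are generated by the stochastic intervals [[T, oo[[ of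
    [G^m]-stopping times, and such a [T] is pulled back from some [Th(v, w)] with the same
    measurability. On [sigma_i <= t < sigma_(i+1)] the vector of the [tau_j] cut at
    [sigma_i] is the vector cut at [t], and replacing [tau] by it does not affect whether
    [Th <= t].

    What remains is that [{Th(v, w) <= t}] is [B^m (x) O(F)]-measurable up to a null set
    of pairs [(v, w)]. Averaging over the cells of a countable partition of the
    [v]-space yields the processes [nu(cell, Th(., w) <= t)], which are cadlag and adapted
    because [F] is right-continuous; along suitable finer and finer partitions the set
    where their ratios to [nu(cell)] do not tend to zero is the desired one. *)

Require Import Defs.
From HB Require Import structures.
From mathcomp Require Import all_boot all_order all_algebra.
From mathcomp Require Import all_classical all_reals all_analysis.
From mathcomp Require Import measurable_realfun.
Import Order.TTheory GRing.Theory Num.Theory.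
Import numFieldNormedType.Exports.
Local Open Scope classical_set_scope.
Local Open Scope ring_scope.

Set Implicit Arguments.
Unset Strict Implicit.
Unset Printing Implicit Defensive.

(** * Approximation by cells *)

Lemma measurableY (d : measure_display) (T : measurableType d) (A B : set T) :
  measurable A -> measurable B -> measurable (A `+` B).
Proof. by move=> mA mB; apply: measurableU; exact: measurableD. Qed.

Lemma bigcup_bound_measure (d : measure_display) (T : measurableType d) (R : realType)
    (mu : {measure set T -> \bar R}) (A : nat -> set T) (b : \bar R) :
  (forall n, measurable (A n)) -> nondecreasing_seq A ->
  (forall n, (mu (A n) <= b)%E) -> (mu (\bigcup_n A n) <= b)%E.
Proof.
move=> mA ndA Ab.
have cv := nondecreasing_cvg_mu (mu := mu) mA (bigcupT_measurable _ mA) ndA.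
rewrite -(cvg_lim _ cv)//.
by apply: lime_le; [exact: cvgP cv|exact: nearW].
Qed.

Lemma measure_cells (d : measure_display) (T : measurableType d) (R : realType)
    (mu : {measure set T -> \bar R}) (c : T -> nat) (A : set T) :
  (forall k, measurable (c @^-1` [set k])) -> measurable A ->
  mu A = (\sum_(k <oo) mu (A `&` c @^-1` [set k]))%E.
Proof.
move=> mc mA.
have {1}-> : A = \bigcup_k (A `&` c @^-1` [set k]).
  by apply/seteqP; split => [x Ax|x [k _ []]//]; exists (c x).
rewrite measure_semi_bigcup//.
- by move=> k; exact: measurableI.
- by apply/trivIsetP => i j _ _ /eqP ij; apply/seteqP; split => // x [[_ ci] [_ cj]]; apply: ij; rewrite -ci -cj.
- by apply: bigcupT_measurable => k; exact: measurableI.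
Qed.

Section cells.
Context {dV d : measure_display} {V : measurableType dV} {Omega : measurableType d}
  {R : realType}.

(** A countable measurable partition is encoded by the label of the cell of each point, so that a
    common refinement is a pairing of labels. *)
Definition cellmap (c : V -> nat) := forall k, measurable (c @^-1` [set k]).

Definition cellset (c : V -> nat) (D : nat -> set Omega) : set (V * Omega) :=
  [set p | D (c p.1) p.2].

Lemma measurable_cellset c D : cellmap c -> (forall k, measurable (D k)) ->
  measurable (cellset c D).
Proof.
move=> mc mD.
have -> : cellset c D = \bigcup_k (c @^-1` [set k] `*` D k).
  apply/seteqP; split=> [[v w] /= Dw|[v w] [k _ [/= <-]]//].
  by exists (c v).
by apply: bigcupT_measurable => k; exact: measurableX.
Qed.

Definition paircell (c1 c2 : V -> nat) (v : V) : nat := pickle (c1 v, c2 v).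

Lemma cellmap_pair c1 c2 : cellmap c1 -> cellmap c2 -> cellmap (paircell c1 c2).
Proof.
move=> m1 m2 k.
rewrite (_ : _ @^-1` _ = \bigcup_i \bigcup_j
  ((c1 @^-1` [set i] `&` c2 @^-1` [set j]) `&` [set _ | pickle (i, j) = k])).
  apply: bigcupT_measurable => i; apply: bigcupT_measurable => j.
  apply: measurableI; first exact: measurableI.
  have [->|nk] := eqVneq (pickle (i, j)) k.
    by rewrite (_ : [set _ | _] = setT)//; exact/seteqP.
  by rewrite (_ : [set _ | _] = set0)//; apply/seteqP; split=> // x /= /eqP; rewrite (negbTE nk).
apply/seteqP; split=> [v /= <-|v [i _ [j _ [/= [<- <-]]]]//].
by exists (c1 v) => //; exists (c2 v).
Qed.

(** Sets indexed by one of two partitions are reread as indexed by their refinement [paircell]; a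
    label that decodes to no pair gets the empty set. *)
Definition lcell (T : Type) (D : nat -> set T) (k : nat) : set T :=
  if @unpickle (nat * nat)%type k is Some (i, _) then D i else set0.
Definition rcell (T : Type) (D : nat -> set T) (k : nat) : set T :=
  if @unpickle (nat * nat)%type k is Some (_, j) then D j else set0.


Lemma measurable_lcell (D : nat -> set Omega) k :
  (forall k, measurable (D k)) -> measurable (lcell D k).
Proof. by move=> mD; rewrite /lcell; case: unpickle => [[i j]|]. Qed.

Lemma measurable_rcell (D : nat -> set Omega) k :
  (forall k, measurable (D k)) -> measurable (rcell D k).
Proof. by move=> mD; rewrite /rcell; case: unpickle => [[i j]|]. Qed.

Lemma lcell_pair c1 c2 (D : nat -> set Omega) v : lcell D (paircell c1 c2 v) = D (c1 v).
Proof. by rewrite /lcell /paircell pickleK. Qed.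

Lemma rcell_pair c1 c2 (D : nat -> set Omega) v : rcell D (paircell c1 c2 v) = D (c2 v).
Proof. by rewrite /rcell /paircell pickleK. Qed.

Variable P : {measure set (V * Omega) -> \bar R}.
Hypothesis Pfin : (P setT < +oo)%E.

Definition cell_approx (C : set (V * Omega)) := forall e : R, 0 < e ->
  exists c D, [/\ cellmap c, forall k, measurable (D k) &
    (P (C `+` cellset c D) < e%:E)%E].

Lemma cell_approxC C : cell_approx C -> cell_approx (~` C).
Proof.
move=> aC e e0; have [c [D [mc mD PC]]] := aC e e0.
exists c, (fun k => ~` D k); split=> //; first by move=> k; exact: measurableC.
suff -> : ~` C `+` cellset c (fun k => ~` D k) = C `+` cellset c D by [].
apply/seteqP; split=> p; rewrite /setY /cellset/=.
  by move=> [[nC /contrapT DC]|[nD /contrapT Cp]]; [right|left].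
by move=> [[Cp nD]|[Dp nC]]; [right|left]; split=> //; apply: contraPnot.
Qed.

(** Both approximants live on the common refinement, and the error of the union is contained in the
    union of the errors. *)
Lemma cell_approxU C1 C2 : measurable C1 -> measurable C2 ->
  cell_approx C1 -> cell_approx C2 -> cell_approx (C1 `|` C2).
Proof.
move=> mC1 mC2 a1 a2 e e0.
have [c1 [D1 [mc1 mD1 P1]]] := a1 (e / 2) (divr_gt0 e0 (ltr0Sn R 1)).
have [c2 [D2 [mc2 mD2 P2]]] := a2 (e / 2) (divr_gt0 e0 (ltr0Sn R 1)).
exists (paircell c1 c2), (fun k => lcell D1 k `|` rcell D2 k).
have mD k : measurable (lcell D1 k `|` rcell D2 k).
  by apply: measurableU; [exact: measurable_lcell|exact: measurable_rcell].
split=> //; first exact: cellmap_pair.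
have m1 : measurable (C1 `+` cellset c1 D1).
  by apply: measurableY => //; exact: measurable_cellset.
have m2 : measurable (C2 `+` cellset c2 D2).
  by apply: measurableY => //; exact: measurable_cellset.
apply: (@le_lt_trans _ _ (P (C1 `+` cellset c1 D1) + P (C2 `+` cellset c2 D2))%E).
  apply: le_trans (measureU2 _ m1 m2).
  apply: le_measure; rewrite ?inE; [|exact: measurableU|].
    apply: measurableY; first exact: measurableU.
    by apply: measurable_cellset => //; exact: cellmap_pair.
  move=> p; rewrite /setY /cellset/= lcell_pair rcell_pair; tauto.
by rewrite [e]splitr EFinD lteD.
Qed.

(** Rectangles have the required form with two cells. Complements and finite unions preserve
    approximability, and since [P] is finite a countable union is close to one of its finite
    subunions. *)
Lemma cell_approx_measurable C : measurable C -> cell_approx C.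
Proof.
suff : measurable `<=` [set C | measurable C /\ cell_approx C] by move=> H /H[].
rewrite {1}measurable_prod_measurableType.
apply: smallest_sub; last first.
  move=> _ [A mA [B mB <-]]; split; first exact: measurableX.
  move=> e e0; exists (fun v => nat_of_bool (v \in A)), (fun k => if k == 1%N then B else set0).
  split.
  - move=> [|[|k]].
    + rewrite (_ : _ @^-1` _ = ~` A); first exact: measurableC.
      apply/seteqP; split=> v /=; first by case: (boolP (v \in A)) => //= /negP nA _ Av; apply: nA; rewrite inE.
      by move=> nA; rewrite memNset.
    + rewrite (_ : _ @^-1` _ = A)//.
      by apply/seteqP; split=> v /=; [case: (boolP (v \in A)) => //=; rewrite inE|move=> Av; rewrite mem_set].
    + by rewrite (_ : _ @^-1` _ = set0)//; apply/seteqP; split=> v //=; case: (v \in A).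
  - by move=> k; case: ifP.
  - rewrite (_ : _ `+` _ = set0) ?measure0//.
    rewrite (_ : cellset _ _ = A `*` B) ?setYK//.
    apply/seteqP; split=> -[v w]; rewrite /cellset/=.
      by case: (boolP (v \in A)) => //=; rewrite inE.
    by move=> [Av Bw]; rewrite mem_set.
split.
- split=> // e e0; exists (fun=> 0%N), (fun=> set0); split=> //.
    by move=> k; rewrite preimage_cst; case: ifP.
  by rewrite (_ : cellset _ _ = set0)// setYK measure0.
- by move=> A [mA aA]; rewrite setTD; split; [exact: measurableC|exact: cell_approxC].
move=> A AP; have mA n := (AP n).1; have aA n := (AP n).2.
split; first exact: bigcupT_measurable.
pose B n := \big[setU/set0]_(i < n.+1) A i.
have mB n : measurable (B n) by exact: bigsetU_measurable.
have aB n : cell_approx (B n).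
  rewrite /B; elim: n => [|n IH]; first by rewrite big_ord1.
  by rewrite big_ord_recr/=; apply: cell_approxU => //; exact: bigsetU_measurable.
have ndB : nondecreasing_seq B.
  by move=> i j ij; apply/subsetPset; apply: subset_bigsetU.
have BA : \bigcup_n B n = \bigcup_n A n.
  apply/seteqP; split=> [x [n _]|x [n _ Ax]].
    by rewrite /B -bigcup_mkord => -[i _ Ai]; exists i.
  by exists n => //; rewrite /B -bigcup_mkord; exists n => /=.
have cv : P \o (fun n => (\bigcup_n A n) `\` B n) @ \oo --> 0%E.
  rewrite -(measure0 P) (_ : set0 = \bigcap_n ((\bigcup_n A n) `\` B n)).
    apply: nonincreasing_cvg_mu.
    - apply: le_lt_trans Pfin; apply: le_measure; rewrite ?inE//.
      by apply: measurableD => //; exact: bigcupT_measurable.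
    - by move=> i; apply: measurableD => //; exact: bigcupT_measurable.
    - by apply: bigcapT_measurable => i; apply: measurableD => //; exact: bigcupT_measurable.
    - by move=> i j ij; apply/subsetPset; apply: setDS; exact/subsetPset/ndB.
  apply/esym/seteqP; split=> // x xB.
  have [+ _] := xB 0%N I; rewrite -BA => -[n _ Bnx].
  by have [] := xB n I.
move=> e e0.
have e20 : 0 < e / 2 by rewrite divr_gt0.
have : \forall n \near \oo, (P ((\bigcup_n A n) `\` B n) < (e / 2)%:E)%E.
  apply: (cv [set x | (x < (e / 2)%:E)%E]); apply: open_nbhs_nbhs; split.
    exact: open_ereal_lt_ereal.
  by rewrite /= lte_fin.
case=> N _ /(_ N (leqnn N)) PN.
have [c [D [mc mD PD]]] := aB N _ e20.
exists c, D; split => //.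
have mUB : measurable ((\bigcup_n A n) `\` B N).
  by apply: measurableD => //; exact: bigcupT_measurable.
have mBD : measurable (B N `+` cellset c D).
  by apply: measurableY => //; exact: measurable_cellset.
apply: (@le_lt_trans _ _ (P ((\bigcup_n A n) `\` B N) + P (B N `+` cellset c D))%E).
  apply: le_trans (measureU2 _ mUB mBD).
  apply: le_measure; rewrite ?inE; [|exact: measurableU|].
    apply: measurableY; first exact: bigcupT_measurable.
    exact: measurable_cellset.
  have BNA : B N `<=` \bigcup_n A n by rewrite -BA; exact: bigcup_sup.
  move=> p; rewrite /setY/= => -[[Ap nD]|[Dp nA]].
    by have [Bp|nB] := pselect (B N p); [right; left|left].
  by right; right; split=> // /BNA.
by rewrite [e]splitr EFinD lteD.
Qed.

(** Each new set refines the partition found so far; the earlier approximants are merely reindexed,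
    so their errors do not grow. *)
Lemma cell_approx_seq (C : nat -> set (V * Omega)) : (forall i, measurable (C i)) ->
  forall n (e : R), 0 < e -> exists2 c, cellmap c & forall i, (i < n)%N ->
    exists2 D, forall k, measurable (D k) & (P (C i `+` cellset c D) < e%:E)%E.
Proof.
move=> mC n e e0; elim: n => [|n [c mc cD]].
  by exists (fun=> 0%N) => // k; rewrite preimage_cst; case: ifP.
have [c' [D' [mc' mD' PD']]] := cell_approx_measurable (mC n) e0.
exists (paircell c c'); first exact: cellmap_pair.
move=> i; rewrite ltnS leq_eqVlt => /predU1P[->|/cD[D mD PD]].
  exists (rcell D') => [k|]; first exact: measurable_rcell.
  rewrite (_ : cellset _ _ = cellset c' D')//.
  by apply/seteqP; split=> p; rewrite /cellset/= rcell_pair.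
exists (lcell D) => [k|]; first exact: measurable_lcell.
rewrite (_ : cellset _ _ = cellset c D)//.
by apply/seteqP; split=> p; rewrite /cellset/= lcell_pair.
Qed.

End cells.

(** In a chain every finite union is one of the members, so the bound holds along the increasing
    finite unions even when the enumeration is not monotone. *)
Lemma chain_bigcup_bound (d : measure_display) (T : measurableType d) (R : realType)
    (mu : {measure set T -> \bar R}) (A : nat -> set T) (b : \bar R) :
  (forall n, measurable (A n)) ->
  (forall i j, A i `<=` A j \/ A j `<=` A i) ->
  (forall n, (mu (A n) <= b)%E) -> (mu (\bigcup_n A n) <= b)%E.
Proof.
move=> mA chA Ab; pose B n := \big[setU/set0]_(i < n.+1) A i.
have BA n : exists i, B n = A i.
  elim: n => [|n [i Bi]]; first by exists 0%N; rewrite /B big_ord1.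
  rewrite /B big_ord_recr/= -/(B n) Bi.
  have [/setUidPr ->|/setUidPl ->] := chA i n.+1; first by exists n.+1.
  by exists i.
have -> : \bigcup_n A n = \bigcup_n B n.
  apply/seteqP; split=> [x [n _ Ax]|x [n _]].
    by exists n => //; rewrite /B -bigcup_mkord; exists n => /=.
  by rewrite /B -bigcup_mkord => -[i _ Ai]; exists i.
apply: bigcup_bound_measure => n.
- by have [i ->] := BA n.
- by move=> j nj; apply/subsetPset; exact: subset_bigsetU.
- by have [i ->] := BA n.
Qed.

Lemma ysectionE (T1 T2 : Type) (A : set (T1 * T2)) w :
  ysection A w = [set v | A (v, w)].
Proof. by apply/seteqP; split=> v /=; rewrite /ysection/= inE. Qed.

(** * Masses of slices within cells *)

Section slices.
Context {dV d : measure_display} {V : measurableType dV} {Omega : measurableType d}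
  {R : realType}.
Variable nu : {finite_measure set V -> \bar R}.
Variable Q : probability Omega R.
Local Notation P := (nu \x^ Q)%E.

Lemma product_setT : P setT = nu setT.
Proof.
rewrite -setXTT [LHS](product_measure2E nu Q measurableT measurableT).
rewrite -[RHS]mule1; congr (_ * _)%E; exact: probability_setT.
Qed.

Lemma product_setT_lty : (P setT < +oo)%E.
Proof.
rewrite product_setT.
by rewrite -ge0_fin_numE// fin_num_measure.
Qed.

Lemma measurable_slice (A : set V) (C : set (V * Omega)) :
  measurable A -> measurable C ->
  measurable_fun setT (fun w => nu (A `&` [set v | C (v, w)])).
Proof.
move=> mA mC.
have := @measurable_fun_ysection _ _ _ Omega R nu ((A `*` setT) `&` C)
  (measurableI _ _ (measurableX mA measurableT) mC).
congr (measurable_fun _ _); apply/funext => w /=; congr (nu _).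
by rewrite ysectionE; apply/seteqP; split=> v /= [] => [[]|].
Qed.

(** The product measure integrates the masses of slices over [w], so an inequality inside each cell
    of each slice is summed over the cells and then integrated. *)
Lemma slice_le c (X Y : set (V * Omega)) (a b : R) : cellmap c ->
  measurable X -> measurable Y -> 0 <= a -> 0 <= b ->
  (forall w k, a%:E * nu ([set v | X (v, w)] `&` c @^-1` [set k]) <=
               b%:E * nu ([set v | Y (v, w)] `&` c @^-1` [set k]))%E ->
  (a%:E * P X <= b%:E * P Y)%E.
Proof.
move=> mc mX mY a0 b0 XY; rewrite /product_measure2.
have mn Z : measurable Z -> measurable_fun setT (nu \o @ysection V Omega Z).
  by move=> mZ; exact: measurable_fun_ysection.
rewrite -!ge0_integralZl//; [|exact: mn|exact: mn].
apply: ge0_le_integral => //.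
- by move=> w _; exact: mule_ge0.
- by apply: measurable_funeM; exact: mn.
- by apply: measurable_funeM; exact: mn.
move=> w _ /=; rewrite !ysectionE.
have mw (Z : set (V * Omega)) : measurable Z -> measurable [set v | Z (v, w)].
  by move=> mZ; rewrite -ysectionE; exact: measurable_ysection.
rewrite (measure_cells nu mc (mw _ mX)) (measure_cells nu mc (mw _ mY)).
rewrite -!nneseriesZl//.
by apply: lee_nneseries => *; [exact: mule_ge0|exact: XY].
Qed.

(** False alarms: the conditional mass of [C] given the cell exceeds [a] although the point is
    outside [C]. The inequality is multiplied out because a cell may be null. *)
Definition cell_excess (c : V -> nat) (C : set (V * Omega)) (a : R) : set (V * Omega) :=
  [set p | ~ C p /\ (a%:E * nu (c @^-1` [set c p.1]) <
     nu (c @^-1` [set c p.1] `&` [set v | C (v, p.2)]))%E].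

Lemma measurable_cell_excess c C a : cellmap c -> measurable C ->
  measurable (cell_excess c C a).
Proof.
move=> mc mC.
rewrite (_ : cell_excess c C a = ~` C `&` cellset c
  (fun k => [set w | (a%:E * nu (c @^-1` [set k]) <
     nu (c @^-1` [set k] `&` [set v | C (v, w)]))%E])); last first.
  by apply/seteqP; split=> p.
apply: measurableI; first exact: measurableC.
apply: measurable_cellset => // k.
rewrite -[X in measurable X]setTI.
apply: emeasurable_fun_o_infty => //; exact: (measurable_slice (mc k) mC).
Qed.

(* [D] is constant on a cell, so in each cell either [C] or its complement lies in the
   error set. *)
Lemma cell_excess_bound c D C (a : R) : cellmap c -> (forall k, measurable (D k)) ->
  measurable C -> 0 <= a <= 1 ->
  (a%:E * P (cell_excess c C a) <= P (C `+` cellset c D))%E.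
Proof.
move=> mc mD mC /andP[a0 a1]; rewrite -[leRHS]mul1e.
apply: (slice_le mc _ _ a0 ler01).
- exact: measurable_cell_excess.
- by apply: measurableY => //; exact: measurable_cellset.
move=> w k; rewrite mul1e.
have mw (Z : set (V * Omega)) : measurable Z -> measurable ([set v | Z (v, w)] `&` c @^-1` [set k]).
  move=> mZ; apply: measurableI => //.
  by rewrite -ysectionE; exact: measurable_ysection.
have mY : measurable (C `+` cellset c D).
  by apply: measurableY => //; exact: measurable_cellset.
have mE : measurable (cell_excess c C a) by exact: measurable_cell_excess.
have [lt|nlt] := pselect (a%:E * nu (c @^-1` [set k]) <
     nu (c @^-1` [set k] `&` [set v | C (v, w)]))%E; last first.
  rewrite (_ : [set v | cell_excess c C a (v, w)] `&` _ = set0) ?measure0 ?mule0//.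
  by apply/seteqP; split=> // v [[/= _] + ck]; rewrite /= in ck; rewrite ck => /nlt.
have [Dk|nDk] := pselect (D k w).
  apply: (@le_trans _ _ (nu ([set v | cell_excess c C a (v, w)] `&` c @^-1` [set k]))).
    rewrite -[leRHS]mul1e; apply: lee_wpmul2r => //.
  apply: le_measure; rewrite ?inE; [exact: (mw _ mE)|exact: (mw _ mY)|].
  move=> v [[/= nC _] ck]; split=> //=; right; split=> //.
  by rewrite /cellset/=; rewrite /= in ck; rewrite ck.
(* Here the whole of [C] in the cell is error; by [lt] it outweighs [a] times the cell, hence [a]
   times the excess set. *)
apply: (@le_trans _ _ (nu (c @^-1` [set k] `&` [set v | C (v, w)]))).
  apply: le_trans (ltW lt); apply: lee_wpmul2l; first by rewrite lee_fin.
  apply: le_measure; rewrite ?inE//; first exact: (mw _ mE).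
rewrite setIC; apply: le_measure; rewrite ?inE; [exact: (mw _ mC)|exact: (mw _ mY)|].
move=> v [/= Cv ck]; split=> //=; left; split=> //.
by rewrite /cellset/=; rewrite /= in ck; rewrite ck.
Qed.

(** At some rational level above [T p], the conditional distribution function of [T] in the cell is
    still at most [a]. Rational levels make this a countable union. *)
Definition early_hit (c : V -> nat) (T : V * Omega -> \bar R) (a : R) : set (V * Omega) :=
  [set p | exists q : rat, (T p < (ratr q)%:E)%E /\
    (nu (c @^-1` [set c p.1] `&` [set v | T (v, p.2) < (ratr q)%:E]) <=
     a%:E * nu (c @^-1` [set c p.1]))%E].

Variable T : V * Omega -> \bar R.
Hypothesis mT : forall x : R, measurable [set p | (T p < x%:E)%E].

Lemma measurable_early_hit c a : cellmap c -> measurable (early_hit c T a).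
Proof.
move=> mc.
rewrite (_ : early_hit c T a = \bigcup_(q : rat) ([set p | (T p < (ratr q)%:E)%E] `&`
  cellset c (fun k => [set w | (nu (c @^-1` [set k] `&` [set v | T (v, w) < (ratr q)%:E]) <=
     a%:E * nu (c @^-1` [set k]))%E]))); last first.
  by apply/seteqP; split=> [p [q [Tq nq]]|p [q _ [Tq nq]]]; exists q.
apply: bigcupT_measurable_rat => q; apply: measurableI => //.
apply: measurable_cellset => // k.
rewrite -[X in measurable X]setTI.
apply: emeasurable_fun_infty_c => //; exact: (measurable_slice (mc k) (mT (ratr q))).
Qed.

(* In a cell, the sets [{T(., w) < q}] of relative mass at most [a] form a chain, so their
   union has relative mass at most [a] as well. *)
Lemma early_hit_bound c (a : R) : cellmap c -> 0 <= a ->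
  (P (early_hit c T a) <= a%:E * nu setT)%E.
Proof.
move=> mc a0; rewrite -[leLHS]mul1e.
rewrite -product_setT.
apply: (slice_le mc _ _ ler01 a0) => //; first exact: measurable_early_hit.
move=> w k; rewrite mul1e.
have -> : [set v | setT (v, w)] `&` c @^-1` [set k] = c @^-1` [set k].
  by apply/seteqP; split=> v //= [].
pose ok (q : rat) := (nu (c @^-1` [set k] `&` [set v | T (v, w) < (ratr q)%:E]) <=
     a%:E * nu (c @^-1` [set k]))%E.
(* Levels with too heavy a sublevel set, and codes of no rational, contribute the empty set, which
   leaves the family a chain. *)
pose A n := if @unpickle rat n is Some q then
  (if ok q then c @^-1` [set k] `&` [set v | T (v, w) < (ratr q)%:E]%E else set0)
  else set0.
have mTw q : measurable [set v | (T (v, w) < q%:E)%E].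
  by have := measurable_ysection w (mT q); rewrite ysectionE.
have mA n : measurable (A n).
  rewrite /A; case: unpickle => // q; case: ifP => // _.
  exact: measurableI.
have -> : [set v | early_hit c T a (v, w)] `&` c @^-1` [set k] = \bigcup_n A n.
  apply/seteqP; split=> [v [[/= q [Tq nq] ck]]|v [n _]].
    have okq : ok q by rewrite /ok -(_ : c v = k).
    by exists (pickle q); [|rewrite /A pickleK okq].
  rewrite /A; case: unpickle => // q; case: ifP => // okq [ck /= Tq].
  by split=> //; exists q; split; [|rewrite /= (_ : c v = k)].
apply: chain_bigcup_bound => //.
  move=> i j; rewrite /A; case: unpickle => [q|]; last by left.
  case: unpickle => [r|]; last by right.
  case: ifP => _; last by left.
  case: ifP => _; last by right.
  have [qr|rq] := leP q r; [left|right]; apply: setIS => v /= /lt_le_trans; apply;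
    by rewrite lee_fin ler_rat// ltW.
move=> n; rewrite /A; case: unpickle => [q|]; last by rewrite measure0 mule_ge0.
by case: ifP => // _; rewrite measure0 mule_ge0.
Qed.

End slices.

Lemma sigma_algebra_setIbigcap (T : Type) (D : set T) (G : set (set T)) (A : nat -> set T) :
  sigma_algebra D G -> (forall n, G (A n)) -> G (D `&` \bigcap_n A n).
Proof.
move=> [_ GD GU] GA.
rewrite (_ : _ `&` _ = D `\` \bigcup_n (D `\` A n)); first by apply: (GD); apply: GU => n; exact: GD.
apply/seteqP; split=> x [Dx Ax]; split=> //.
  by move=> [n _ [_]]; apply; exact: Ax.
by move=> n _; apply: contrapT => nA; apply: Ax; exists n.
Qed.

Lemma measurable_prod_coarser (d1 d2 : measure_display) (T1 : measurableType d1)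
    (T2 : measurableType d2) (G : set (set T2)) (A : set (T1 * T2)) :
  G `<=` measurable ->
  (@measurable _ (T1 * g_sigma_algebraType G)%type A) -> measurable A.
Proof.
move=> Gm; rewrite measurable_prod_measurableType.
suff : <<s [set B `*` C | B in @measurable _ T1 & C in @measurable _ (g_sigma_algebraType G)] >>
  `<=` @measurable _ (T1 * T2)%type by exact.
apply: smallest_sub; first exact: sigma_algebra_measurable.
move=> _ [B mB [C mC <-]]; apply: measurableX => //.
move: C mC; apply: smallest_sub => //; exact: sigma_algebra_measurable.
Qed.

Lemma measurable_prod_g_sigma_sub (d1 : measure_display) (T1 : measurableType d1)
    (T2 : pointedType) (G H : set (set T2)) (A : set (T1 * T2)) :
  G `<=` H -> @measurable _ (T1 * g_sigma_algebraType G)%type A ->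
  @measurable _ (T1 * g_sigma_algebraType H)%type A.
Proof.
move=> GH; rewrite !measurable_prod_measurableType; move: A.
apply: sub_smallest2r; first exact: smallest_sigma_algebra.
move=> _ [B mB [C mC <-]]; exists B => //; exists C => //.
move: C mC; apply: sub_smallest2r => //; exact: smallest_sigma_algebra.
Qed.

(** * Distribution functions under a finite measure *)

Section distribution_function.
Context {dV : measure_display} {V : measurableType dV} {R : realType}.
Variables (nu : {finite_measure set V -> \bar R}) (A : set V) (f : V -> \bar R).
Hypothesis mA : measurable A.
Hypothesis mf : forall x : R, measurable [set v | (f v < x%:E)%E].

(** The free step [e] keeps all levels below a chosen horizon: with [e = s - t] they stay in the
    interval from [t] to [s]. *)
Lemma sublevel_le_bigcap (x : \bar R) (t e : R) : 0 < e ->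
  (x <= t%:E)%E <-> forall n : nat, (x < (t + e / n.+1%:R)%:E)%E.
Proof.
move=> e0; split=> [xt n|H].
  by apply: le_lt_trans xt _; rewrite lte_fin ltrDl divr_gt0.
apply/lee_addgt0Pr => r r0.
have [n nr] : exists n : nat, e / n.+1%:R < r.
  have [n _ /(_ n (leqnn n)) /= H'] := near_infty_natSinv_lt (PosNum (divr_gt0 r0 e0)).
  by exists n; rewrite mulrC -ltr_pdivlMr.
apply: le_trans (ltW (H n)) _; rewrite -EFinD lee_fin lerD2l; exact: ltW.
Qed.

Lemma measurable_sublevel_le (t : R) : measurable [set v | (f v <= t%:E)%E].
Proof.
rewrite (_ : [set _ | _] = \bigcap_(n : nat) [set v | (f v < (t + 1 / n.+1%:R)%:E)%E]).
  by apply: bigcapT_measurable.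
apply/seteqP; split=> [v /= /(sublevel_le_bigcap _ _ ltr01) H n _ /=|v /= H]; first exact: H.
by apply/(sublevel_le_bigcap _ _ ltr01) => n; exact: H.
Qed.

Definition dfun (t : R) : R := fine (nu (A `&` [set v | (f v <= t%:E)%E])).

Let mAf t : measurable (A `&` [set v | (f v <= t%:E)%E]).
Proof. by apply: measurableI => //; exact: measurable_sublevel_le. Qed.

Lemma dfun_fineK t : (dfun t)%:E = nu (A `&` [set v | (f v <= t%:E)%E]).
Proof. by rewrite /dfun fineK// fin_num_measure. Qed.

Lemma dfun_ndecr : {homo dfun : s t / s <= t}.
Proof.
move=> s t st; rewrite -lee_fin !dfun_fineK; apply: le_measure; rewrite ?inE//.
by apply: setIS => v /= /le_trans; apply; rewrite lee_fin.
Qed.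

Lemma dfun_le t : dfun t <= fine (nu setT).
Proof.
rewrite -lee_fin dfun_fineK fineK ?fin_num_measure//.
by apply: le_measure; rewrite ?inE.
Qed.

(** Continuity from above of the finite measure gives the limit along [t + 1 / n.+1], and
    monotonicity extends it to all [s] to the right of [t]. *)
Lemma dfun_right_cont t : dfun @ t^'+ --> dfun t.
Proof.
pose B n := A `&` [set v | (f v <= (t + 1 / n.+1%:R)%:E)%E].
have Bcap : \bigcap_n B n = A `&` [set v | (f v <= t%:E)%E].
  apply/seteqP; split=> [v Bv|v [Av fv] n _].
    split; first by have [] := Bv 0%N I.
    apply/lee_addgt0Pr => r r0; rewrite -EFinD.
    have [n _ /(_ n (leqnn n)) /= H] := near_infty_natSinv_lt (PosNum r0).
    have [_ /= /le_trans] := Bv n I; apply.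
    by rewrite lee_fin lerD2l div1r ltW.
  split=> //=; apply: le_trans fv _; by rewrite lee_fin lerDl.
have cv : nu \o B @ \oo --> nu (A `&` [set v | (f v <= t%:E)%E]).
  rewrite -Bcap; apply: nonincreasing_cvg_mu.
  - by rewrite -ge0_fin_numE// fin_num_measure//; exact: mAf.
  - by move=> n; exact: mAf.
  - by rewrite Bcap; exact: mAf.
  - move=> i j ij; apply/subsetPset; apply: setIS => v /= /le_trans; apply.
    by rewrite lee_fin lerD2l !div1r lef_pV2 ?posrE// ler_nat.
apply/cvgrPdist_le => e e0.
have : \forall n \near \oo, (nu (B n) < (dfun t + e)%:E)%E.
  apply: (cv [set x | (x < (dfun t + e)%:E)%E]); apply: open_nbhs_nbhs; split.
    exact: open_ereal_lt_ereal.
  by rewrite /= -dfun_fineK lte_fin ltrDl.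
case=> n _ /(_ n (leqnn n)); rewrite /B -dfun_fineK lte_fin => Hn.
near=> s.
have ts : t <= s by near: s; exact: nbhs_right_ge.
rewrite distrC ger0_norm ?subr_ge0 ?dfun_ndecr// lerBlDl.
apply: le_trans (ltW Hn); apply: dfun_ndecr; near: s.
apply: nbhs_right_le; by rewrite ltrDl.
Unshelve. all: by end_near. Qed.

Lemma dfun_left_lim t : cvg (dfun @ t^'-).
Proof.
apply: nondecreasing_at_left_is_cvgr.
- by near=> x => a b _ _; exact: dfun_ndecr.
- by near=> x; exists (fine (nu setT)) => _ [s _ <-]; exact: dfun_le.
Unshelve. all: by end_near. Qed.

(** A failure of the bound at [t] would persist, by right continuity, at some [s] beyond [t], and a
    rational level between [t] and [s] excludes it. *)
Lemma dfun_ge_limit (t : R) (b : \bar R) :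
  (forall q : rat, t < ratr q -> (b <= nu (A `&` [set v | (f v < (ratr q)%:E)%E]))%E) ->
  (b <= (dfun t)%:E)%E.
Proof.
move=> H; have cv := @dfun_right_cont t.
rewrite leNgt; apply/negP => dtb.
have db : \forall s \near t^'+, ((dfun s)%:E < b)%E.
  apply: (cv [set x : R | (x%:E < b)%E]); apply: open_nbhs_nbhs; split => //.
  exact: open_ereal_lt.
near t^'+ => s.
have ts : t < s by near: s; exact: nbhs_right_gt.
have [q] := rat_in_itvoo ts; rewrite in_itv/= => /andP[tq qs].
have : ((dfun s)%:E < b)%E by near: s.
rewrite ltNge => /negP; apply; apply: le_trans (H q tq) _.
rewrite dfun_fineK; apply: le_measure; rewrite ?inE//; first exact: measurableI.
apply: setIS => v /= /ltW /le_trans; apply; by rewrite lee_fin ltW.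
Unshelve. all: by end_near. Qed.

End distribution_function.

(** * Stopping times with a parameter *)

Section parametrized_stopping_time.
Context {dV d : measure_display} {V : measurableType dV} {Omega : measurableType d}
  {R : realType}.
Variable nu : {finite_measure set V -> \bar R}.
Variable Q : probability Omega R.
Local Notation P := (nu \x^ Q)%E.
Variable F : R -> set (set Omega).
Hypothesis FS : forall t, 0 <= t -> sigma_algebra setT (F t).
Hypothesis Fm : forall t, 0 <= t -> F t `<=` measurable.
Hypothesis Fnd : forall s t, 0 <= s -> s <= t -> F s `<=` F t.
Hypothesis Frc : forall t, 0 <= t -> F t = [set A | forall s, t < s -> F s A].
Variable T : V * Omega -> \bar R.
Hypothesis T0 : forall p, (0 <= T p)%E.
Hypothesis mTF : forall s : R, 0 < s ->
  @measurable _ (V * g_sigma_algebraType (F s))%type [set p | (T p < s%:E)%E].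

Lemma measurable_stop_lt (x : R) : measurable [set p | (T p < x%:E)%E].
Proof.
have [x0|x0] := ltP 0 x; first exact: (measurable_prod_coarser (Fm (ltW x0)) (mTF x0)).
rewrite (_ : [set _ | _] = set0)//; apply/seteqP; split=> // p /= /(le_lt_trans (T0 p)).
by rewrite lte_fin ltNge x0.
Qed.

Lemma measurable_stop_lt_slice (w : Omega) (x : R) :
  measurable [set v | (T (v, w) < x%:E)%E].
Proof. by have := measurable_ysection w (measurable_stop_lt x); rewrite ysectionE. Qed.

Definition cell_process (A : set V) (t : R) (w : Omega) : R :=
  dfun nu A (fun v => T (v, w)) t.

(** By right continuity of [F], adaptedness at [t] only asks for [F s]-measurability for each
    [s > t]. There [T <= t] is a countable intersection of events [T < u] with [u <= s], and the
    mass of its slices is measurable by Fubini. *)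
Lemma cell_process_cadlag A : measurable A -> cadlag_adapted F (cell_process A).
Proof.
move=> mA; split; [|split].
- move=> t t0 B mB; rewrite Frc// => s ts.
  have s0 : 0 <= s by rewrite (le_trans t0)// ltW.
  pose Os : measurableType _ := g_sigma_algebraType (F s).
  have mle : @measurable _ (V * Os)%type [set p | (T p <= t%:E)%E].
    rewrite (_ : [set _ | _] = \bigcap_(n : nat) [set p | (T p < (t + (s - t) / n.+1%:R)%:E)%E]).
      apply: bigcapT_measurable => n.
      have tn : t + (s - t) / n.+1%:R <= s.
        rewrite -lerBrDl ler_pdivrMr// ler_peMr ?subr_ge0 ?(ltW ts)//.
        by rewrite ler1n.
      have tn0 : 0 < t + (s - t) / n.+1%:R.
        by rewrite ltr_wpDl// divr_gt0// subr_gt0.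
      exact: measurable_prod_g_sigma_sub (Fnd (ltW tn0) tn) (mTF tn0).
    apply/seteqP; split=> [p /= /(sublevel_le_bigcap _ _ _) H n _|p /= H].
      by apply: H; rewrite subr_gt0.
    by apply/(@sublevel_le_bigcap _ _ _ (s - t)); rewrite ?subr_gt0// => n; exact: H.
  have mX : measurable_fun setT (cell_process A t : Os -> R).
    rewrite /cell_process/dfun; apply: measurableT_comp => //.
    exact: (measurable_slice nu mA mle).
  have := mX measurableT B mB; rewrite setTI.
  rewrite /= /measurable/= (sigma_algebra_id (FS s0)).
  by [].
- move=> w t t0; apply: dfun_right_cont => //; exact: measurable_stop_lt_slice.
- move=> w t t0; apply: dfun_left_lim => //; exact: measurable_stop_lt_slice.
Qed.

Lemma optional_cell_process A (x : \bar R) : measurable A ->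
  optional F (Dplus `&` [set p | (x < (cell_process A p.1 p.2)%:E)%E]).
Proof.
move=> mA; apply: sub_sigma_algebra.
exists (cell_process A), [set r : R | (x < r%:E)%E]; split=> //.
- exact: cell_process_cadlag.
- case: x => [r| |].
  + rewrite (_ : [set _ | _] = `]r, +oo[%classic)//.
    by apply/seteqP; split=> y /=; rewrite in_itv/= andbT lte_fin.
  + by rewrite (_ : [set _ | _] = set0)//; apply/seteqP; split.
  + by rewrite (_ : [set _ | _] = setT)//; apply/seteqP; split=> // y _ /=; rewrite ltNyr.
Qed.

(* [E] is the set where the conditional law of [T(., w)] given the current cell of ever
   finer partitions keeps charging [[0, t]]. After [T] this holds since the conditional
   distribution function, evaluated at [T] itself, is below [a] with probability at
   most [a]; before [T] it fails since the partitions resolve the sets [{T < q}]. *)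
Lemma parametrized_stopping_time_optional :
  exists (E : set (V * (R * Omega))) (S : set (V * Omega)),
  [/\ <<s setT `*` Dplus, [set A `*` C | A in measurable & C in optional F] >> E,
      measurable S, P S = 0%E &
      forall v w t, ~ S (v, w) -> 0 <= t -> (E (v, (t, w)) <-> (T (v, w) <= t%:E)%E)].
Proof.
pose q i : R := if @unpickle rat i is Some r then ratr r else 0.
pose C i := [set p | (T p < (q i)%:E)%E].
have mC i : measurable (C i) by exact: measurable_stop_lt.
(* The [n]-th partition resolves the first [n] sets [C i] with an error that is summable in [n], as
   Borel-Cantelli requires. *)
have /choice[c cP] : forall n : nat, exists c, cellmap c /\ forall i, (i < n)%N ->
    exists2 D, forall k, measurable (D k) & (P (C i `+` cellset c D) < (1 / (2 ^ n.+1)%:R)%:E)%E.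
  move=> n; have e0 : 0 < (1 / (2 ^ n.+1)%:R : R) by rewrite divr_gt0// ltr0n expn_gt0.
  by have [c mc cD] := cell_approx_seq (product_setT_lty nu Q) mC n e0; exists c.
have mc n : cellmap (c n) by have [] := cP n.
pose a (j : nat) : R := j.+1%:R^-1.
have a0 j : 0 < a j by rewrite invr_gt0.
have a1 j : 0 <= a j <= 1 by rewrite ltW//= invf_le1// ler1n.
(* The conditional mass of [T <= t] in the current cell exceeds [a j]. For a fixed cell this is an
   optional condition on [(t, w)], so [En n j] is a countable union of rectangles. *)
pose En n j : set (V * (R * Omega)) := \bigcup_k (c n @^-1` [set k] `*`
   (Dplus `&` [set p | ((a j)%:E * nu (c n @^-1` [set k]) <
      (cell_process (c n @^-1` [set k]) p.1 p.2)%:E)%E])).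
pose E := \bigcup_j ((setT `*` Dplus) `&` lim_sup_set (En ^~ j)).
(* [S1] holds the pairs with false alarms for infinitely many [n]; [S2] those that, at every
   threshold [a j], are early hits for all large [n]. *)
pose S1 := \bigcup_i \bigcup_j lim_sup_set (fun n => cell_excess nu (c n) (C i) (a j)).
pose S2 := \bigcap_j \bigcup_N \bigcap_(n in [set n | (N <= n)%N]) early_hit nu (c n) T (a j).
have mU n j : measurable (early_hit nu (c n) T (a j)).
  by apply: measurable_early_hit => //; exact: measurable_stop_lt.
have mI N j : measurable (\bigcap_(n in [set n | (N <= n)%N]) early_hit nu (c n) T (a j)).
  by apply: bigcap_measurable => //; exists N => /=.
have mX i j n : measurable (cell_excess nu (c n) (C i) (a j)).
  exact: measurable_cell_excess.
have mS1 : measurable S1.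
  apply: bigcupT_measurable => i; apply: bigcupT_measurable => j.
  by apply: bigcapT_measurable => n; exact: bigcup_measurable.
have mS2j j : measurable (\bigcup_N \bigcap_(n in [set n | (N <= n)%N]) early_hit nu (c n) T (a j)).
  exact: bigcupT_measurable.
have mS2 : measurable S2 by exact: bigcapT_measurable.
exists E, (S1 `|` S2); split.
- have sE := smallest_sigma_algebra (setT `*` Dplus : set (V * (R * Omega)))
    [set A `*` C | A in measurable & C in optional F].
  have [_ _ sU] := sE.
  apply: (sU) => j.
  have mEn n : <<s setT `*` Dplus, [set A `*` C | A in measurable & C in optional F] >> (En n j).
    apply: (sU) => k; apply: sub_sigma_algebra.
    exists (c n @^-1` [set k]); first exact: mc.
    by eexists; [exact: (optional_cell_process ((a j)%:E * nu (c n @^-1` [set k]))%E (mc n k))|].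
  apply: (sigma_algebra_setIbigcap sE) => N; rewrite bigcup_mkcond; apply: (sU) => n; case: ifP => // _.
  exact: sigma_algebra0.
- exact: measurableU.
- have S10 : P S1 = 0%E.
    apply: measure_negligible => //.
    apply: negligible_bigcup => i; apply: negligible_bigcup => j.
    (* The partitions with [n <= i] carry no guarantee about [C i]; emptying these finitely many
       terms leaves the upper limit unchanged. *)
    pose B n := if (n <= i)%N then set0 else cell_excess nu (c n) (C i) (a j).
    have mB n : measurable (B n) by rewrite /B; case: ifP.
    apply: (@negligibleS _ _ _ _ (lim_sup_set B)).
      move=> p Hp n _; have [k /= nk pk] := Hp (maxn n i.+1) I.
      move: nk; rewrite geq_max => /andP[nk ik].
      by exists k => //=; rewrite /B leqNgt ik.
    apply/negligibleP; first by apply: bigcapT_measurable => n; exact: bigcup_measurable.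
    apply: lim_sup_set_cvg0 => //.
    have ai0 : 0 <= (a j)^-1 by rewrite invr_ge0 ltW.
    apply: (@le_lt_trans _ _ (\sum_(n <oo) ((a j)^-1 / (2 ^ n.+1)%:R)%:E)%E); last first.
      have /le_lt_trans := epsilon_trick0 xpredT ai0; apply; exact: ltry.
    apply: lee_nneseries => // n _; rewrite /B; case: ifPn => [_|].
      by rewrite measure0 lee_fin divr_ge0.
    rewrite -ltnNge => ni.
    have [_ /(_ i ni)[D mD PD]] := cP n.
    rewrite EFinM lee_pdivlMl//.
    apply: le_trans (cell_excess_bound nu Q (mc n) mD (mC i) (a1 j)) _.
    by rewrite -[X in (_ <= X%:E)%E]div1r ltW.
  have S20 : P S2 = 0%E.
    apply/eqP; rewrite eq_le measure_ge0 andbT.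
    apply/lee_addgt0Pr => e e0; rewrite add0e.
    set N := fine (nu setT).
    have NE : N%:E = nu setT by rewrite /N fineK// fin_num_measure.
    have N0 : 0 <= N by rewrite -lee_fin NE.
    (* Dividing by [N + 1] covers the case where [nu] has mass zero. *)
    have eN : 0 < e / (N + 1) by rewrite divr_gt0// ltr_wpDl.
    have [j _ /(_ j (leqnn j)) /= Hj] := near_infty_natSinv_lt (PosNum eN).
    apply: (@le_trans _ _ ((a j)%:E * nu setT)%E).
      apply: le_trans (_ : (_ <= P (\bigcup_N \bigcap_(n in [set n | (N <= n)%N]) early_hit nu (c n) T (a j)))%E) _.
        by apply: le_measure; rewrite ?inE//; exact: bigcap_inf.
      apply: (@bigcup_bound_measure _ _ _ (nu \x^ Q)%E) => //.
        move=> m n mn; apply/subsetPset => p Hp k /= nk; apply: Hp => /=.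
        exact: leq_trans nk.
      move=> n; apply: le_trans (early_hit_bound nu Q measurable_stop_lt (mc n) (ltW (a0 j))).
      by apply: le_measure; rewrite ?inE// => p; apply => /=.
    rewrite -NE -EFinM lee_fin.
    move: Hj; rewrite ltr_pdivlMr ?ltr_wpDl// => /ltW; apply: le_trans.
    by rewrite ler_pM2l// lerDl.
  apply: measure_negligible; first exact: measurableU.
  by apply: negligibleU; apply/negligibleP.
- move=> v w t nS t0; split=> [[j _ [_ Ej]]|Tt].
    rewrite leNgt; apply/negP => tT.
    (* With a rational [r] after [t] and at most [T], the mass of [T <= t] is part of the mass of
       [T < r], while the pair lies outside that set: a false alarm for infinitely many [n]. *)
    have [r /andP[tr rT]] : exists r : rat, (t < ratr r) && ((ratr r)%:E <= T (v, w))%E.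
      move: tT; case: (T (v, w)) => [x| |//].
        rewrite lte_fin => /rat_in_itvoo[r]; rewrite in_itv/= => /andP[tr rx].
        by exists r; rewrite tr lee_fin ltW.
      move=> _; have /rat_in_itvoo[r] : t < t + 1 by rewrite ltrDl.
      by rewrite in_itv/= => /andP[tr _]; exists r; rewrite tr leey.
    apply: nS; left; exists (pickle r) => //; exists j => // N _.
    have [n /= Nn [k _ [/= ck [_ /= lt]]]] := Ej N I.
    exists n => //; split.
      by rewrite /C /q pickleK/=; apply/negP; rewrite -leNgt.
    rewrite /= (_ : c n v = k)//; apply: lt_le_trans lt _.
    rewrite dfun_fineK; [|exact: mc|exact: measurable_stop_lt_slice].
    apply: le_measure; rewrite ?inE.
    + apply: measurableI; first exact: mc.
      by apply: measurable_sublevel_le; exact: measurable_stop_lt_slice.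
    + by apply: measurableI; [exact: mc|exact: measurable_stop_lt_slice].
    + apply: setIS => v' /= /le_lt_trans; apply.
      by rewrite /q pickleK lte_fin.
  have : ~ S2 (v, w) by move=> S2p; apply: nS; right.
  move=> /existsNP[j /not_implyP[_ Hj]].
  (* The limit of rational levels down to [t] only yields a weak inequality with [a j]; the smaller
     threshold [a j.+1] makes it strict. *)
  exists j.+1 => //; split; first by split.
  move=> N _.
  have [n /not_implyP[/= Nn neh]] : exists n, ~ ([set n | (N <= n)%N] n -> early_hit nu (c n) T (a j) (v, w)).
    by apply/existsNP => H; apply: Hj; exists N => // n; exact: H.
  exists n => //; exists (c n v) => //; split=> //; split=> //=.
  set A := c n @^-1` [set c n v].
  have mA : measurable A by exact: mc.
  have lt (r : rat) : t < ratr r ->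
      ((a j)%:E * nu A < nu (A `&` [set v' | (T (v', w) < (ratr r)%:E)%E]))%E.
    move=> tr; rewrite ltNge; apply/negP => le; apply: neh; exists r; split=> //.
    by apply: le_lt_trans Tt _; rewrite lte_fin.
  (* Lowering the threshold gains strictness only on a cell of positive mass, which [lt]
     provides. *)
  have nuA : (0 < nu A)%E.
    have /rat_in_itvoo[r] : t < t + 1 by rewrite ltrDl.
    rewrite in_itv/= => /andP[/lt ltr _].
    apply: le_lt_trans (_ : (_ <= (a j)%:E * nu A)%E) _.
      by rewrite mule_ge0// lee_fin ltW.
    apply: lt_le_trans ltr _; apply: le_measure; rewrite ?inE//.
    by apply: measurableI => //; exact: measurable_stop_lt_slice.
  apply: (@lt_le_trans _ _ ((a j)%:E * nu A)%E).
    rewrite lte_pmul2r// ?fin_num_measure// lte_fin /a.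
    by rewrite ltf_pV2 ?posrE// ltr_nat.
  apply: dfun_ge_limit => //; first exact: measurable_stop_lt_slice.
  by move=> r tr; exact/ltW/lt.
Qed.

End parametrized_stopping_time.

(** * Stopping times generate the optional sigma-algebra *)

Section optional_generation.
Context {d : measure_display} {Omega : measurableType d} {R : realType}.
Variable G : R -> set (set Omega).
Hypothesis GS : forall t, 0 <= t -> sigma_algebra setT (G t).
Hypothesis Gnd : forall s t, 0 <= s -> s <= t -> G s `<=` G t.

(** Stopping times in the wide sense: the strict inequality is what a countable union over rational
    times yields. *)
Definition wide_stopping_time (T : Omega -> \bar R) :=
  (forall w, (0 <= T w)%E) /\ forall u : R, 0 < u -> G u [set w | (T w < u%:E)%E].

Definition debut (P : Omega -> R -> Prop) (w : Omega) : \bar R :=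
  ereal_inf [set s%:E | s in P w].

Lemma debut_le P w s : P w s -> (debut P w <= s%:E)%E.
Proof. by move=> Ps; apply: ereal_inf_lbound; exists s. Qed.

Lemma debut_ltP P w (u : R) :
  (debut P w < u%:E)%E <-> exists2 s, P w s & s < u.
Proof.
split=> [/ereal_inf_lt[_ [s Ps <-]]|[s Ps su]]; first by rewrite lte_fin; exists s.
by apply: le_lt_trans (debut_le Ps) _; rewrite lte_fin.
Qed.

Lemma debut_ge P w x : (forall s, P w s -> (x <= s%:E)%E) -> (x <= debut P w)%E.
Proof. by move=> H; apply: le_ereal_inf_tmp => _ [s Ps <-]; exact: H. Qed.

(** Once the condition holds it persists for a short while, so a debut before [u] is witnessed at a
    rational time before [u]. *)
Lemma wide_stopping_debut P :
  (forall w s, P w s -> 0 <= s) ->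
  (forall s, 0 <= s -> G s [set w | P w s]) ->
  (forall w s, P w s -> exists2 u, s < u & forall r, s <= r < u -> P w r) ->
  wide_stopping_time (debut P).
Proof.
move=> P0 PG Pr; split=> [w|u u0].
  by apply: debut_ge => s /P0; rewrite lee_fin.
have [G0 GC GU] := GS (ltW u0).
rewrite (_ : [set _ | _] = \bigcup_n (if @unpickle rat n is Some q then
  (if (0 <= ratr q :> R) && (ratr q < u) then [set w | P w (ratr q)] else set0)
  else set0)).
  apply: GU => n; case: unpickle => // q; case: ifP => // /andP[q0 qu].
  exact: Gnd q0 (ltW qu) _ (PG _ q0).
apply/seteqP; split=> w /=.
  move=> /debut_ltP[s Ps su]; have [v sv Hv] := Pr _ _ Ps.
  have /rat_in_itvoo[q] : s < Num.min u v by rewrite lt_min su.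
  rewrite in_itv/= lt_min => /and3P[sq qu qv].
  exists (pickle q); first exact: I.
  rewrite pickleK qu (le_trans (P0 _ _ Ps) (ltW sq)) /=.
  by apply: Hv; rewrite (ltW sq).
move=> [n _]; case: unpickle => // q; case: ifP => // /andP[q0 qu] Pq.
by apply/debut_ltP; exists (ratr q).
Qed.

Section cadlag.
Variable X : R -> Omega -> R.
Hypothesis Xc : cadlag_adapted G X.

Lemma cadlag_right_gt w t x : 0 <= t -> x < X t w ->
  exists2 u, t < u & forall s, t <= s < u -> x < X s w.
Proof.
move=> t0 xX; have [_ [rc _]] := Xc.
have := cvgr_gt _ (rc w t t0) _ xX.
case=> e /= e0 H; exists (t + e); first by rewrite ltrDl.
move=> s /andP[]; rewrite le_eqVlt => /predU1P[<-//|ts] se.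
by apply: H => //=; rewrite ltr0_norm ?subr_lt0// opprB ltrBlDl.
Qed.

Lemma cadlag_right_lt w t x : 0 <= t -> X t w < x ->
  exists2 u, t < u & forall s, t <= s < u -> X s w < x.
Proof.
move=> t0 xX; have [_ [rc _]] := Xc.
have := cvgr_lt _ (rc w t t0) _ xX.
case=> e /= e0 H; exists (t + e); first by rewrite ltrDl.
move=> s /andP[]; rewrite le_eqVlt => /predU1P[<-//|ts] se.
by apply: H => //=; rewrite ltr0_norm ?subr_lt0// opprB ltrBlDl.
Qed.

(** The two cases compare [a] with the left limit at [t]: either it exceeds [a], with room for some
    [b] in between, or [X] finally drops below every level above [a]. *)
Lemma cadlag_left_split w t a : 0 < t -> exists2 p, 0 <= p < t &
  (exists2 b, a < b & forall s, p <= s < t -> b < X s w) \/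
  (forall b, a < b -> exists2 p', p <= p' < t & forall s, p' <= s < t -> X s w < b).
Proof.
move=> t0; have [_ [_ /(_ w t t0) cl]] := Xc.
set l := lim _ in cl.
have [al|la] := ltP a l.
  have [b /andP[ab bl]] : exists b, a < b < l by exists ((a + l) / 2); rewrite !midf_lt.
  have [e /= e0 H] := cvgr_gt _ cl _ bl.
  exists (Num.max 0 (t - e / 2)).
    by rewrite le_max lexx/= gt_max t0/= ltrBlDr ltrDl divr_gt0.
  left; exists b => // s /andP[]; rewrite ge_max => /andP[s0 tes] st.
  apply: H => //=; rewrite gtr0_norm ?subr_gt0// ltrBlDr -ltrBlDl.
  by apply: lt_le_trans tes; rewrite ltrD2l ltrN2 ltr_pdivrMr// ltr_pMr// ltr1n.
exists 0; rewrite ?lexx//; right=> b ab.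
have lb : l < b by exact: le_lt_trans ab.
have [e /= e0 H] := cvgr_lt _ cl _ lb.
exists (Num.max 0 (t - e / 2)).
  by rewrite le_max lexx/= gt_max t0/= ltrBlDr ltrDl divr_gt0.
move=> s /andP[]; rewrite ge_max => /andP[s0 tes] st.
apply: H => //=; rewrite gtr0_norm ?subr_gt0// ltrBlDr -ltrBlDl.
by apply: lt_le_trans tes; rewrite ltrD2l ltrN2 ltr_pdivrMr// ltr_pMr// ltr1n.
Qed.

Definition entrance (p b : R) : Omega -> \bar R :=
  debut (fun w s => p <= s /\ b < X s w).
(** The time must come strictly after the entrance, because only the strict event [entrance < s] is
    known to belong to [G s]. *)
Definition exit (p b a : R) : Omega -> \bar R :=
  debut (fun w s => (entrance p b w < s%:E)%E /\ X s w < a).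

Lemma entrance_ge p b w : (p%:E <= entrance p b w)%E.
Proof. by apply: debut_ge => s []; rewrite lee_fin. Qed.

Lemma wide_stopping_entrance p b : 0 <= p -> wide_stopping_time (entrance p b).
Proof.
move=> p0; have [Xa _] := Xc; apply: wide_stopping_debut.
- by move=> w s [/(le_trans p0)].
- move=> s s0; have [G0 _ _] := GS s0.
  have [ps|ps] := leP p s; last first.
    by rewrite (_ : [set _ | _] = set0)//; apply/seteqP; split=> // w /= [].
  rewrite (_ : [set _ | _] = X s @^-1` `]b, +oo[%classic); first exact: Xa.
  by apply/seteqP; split=> w /=; rewrite in_itv/= andbT => // -[].
- move=> w s [ps bX]; have [u su H] := cadlag_right_gt (le_trans p0 ps) bX.
  exists u => // r /andP[sr ru]; split; first exact: le_trans sr.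
  by apply: H; rewrite sr.
Qed.

Lemma wide_stopping_exit p b a : 0 <= p -> wide_stopping_time (exit p b a).
Proof.
move=> p0; have [Xa _] := Xc; have [_ Se] := wide_stopping_entrance b p0.
have e0 w : (0 <= entrance p b w)%E.
  by apply: le_trans (entrance_ge p b w); rewrite lee_fin.
apply: wide_stopping_debut.
- by move=> w s [/(le_lt_trans (e0 w))]; rewrite lte_fin => /ltW.
- move=> s; rewrite le_eqVlt => /predU1P[<-|s0].
    have [G0 _ _] := GS (lexx (0 : R)).
    rewrite (_ : [set _ | _] = set0)//; apply/seteqP; split=> // w /= [].
    by rewrite ltNge e0.
  have sG := GS (ltW s0).
  rewrite (_ : [set _ | _] = [set w | (entrance p b w < s%:E)%E] `&`
    X s @^-1` `]-oo, a[%classic); last first.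
    by apply/seteqP; split=> w /=; rewrite in_itv.
  have /(sigma_algebraP (fun _ _ => @subsetT _ _))[_ _ _] := sG; apply; first exact: Se.
  by apply: Xa => //; exact: ltW.
- move=> w s [es Xs].
  have s0 : 0 <= s by move: es => /(le_lt_trans (e0 w)); rewrite lte_fin => /ltW.
  have [u su H] := cadlag_right_lt s0 Xs.
  exists u => // r /andP[sr ru]; split; last by apply: H; rewrite sr.
  by apply: lt_le_trans es _; rewrite lee_fin.
Qed.

(* The start [p] is taken just before [t]; when the left limit at [t] is at most [a], the
   entrance time is [t] itself. *)
Lemma cadlag_gtP a w t : 0 <= t -> a < X t w <->
  exists (x y p : rat), [/\ a < ratr x, ratr x < ratr y :> R, 0 <= ratr p :> R,
    (entrance (ratr p) (ratr y) w <= t%:E)%E &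
    ~ (exit (ratr p) (ratr y) (ratr x) w <= t%:E)%E].
Proof.
move=> t0; split; last first.
  move=> [x [y [p [ax xy p0 en ex]]]]; rewrite ltNge; apply/negP => Xa.
  have Xx : X t w < ratr x by exact: le_lt_trans ax.
  (* An entrance exactly at [t] needs values above [ratr y] immediately after [t], against right
     continuity. An entrance before [t] makes [t] itself an exit time. *)
  move: en; rewrite le_eqVlt => /predU1P[en|en].
    have [u tu H] := cadlag_right_lt t0 (lt_trans Xx xy).
    have : (entrance (ratr p) (ratr y) w < u%:E)%E by rewrite en lte_fin.
    move=> /debut_ltP[s [ps ys] su].
    have : X s w < ratr y.
      apply: H; rewrite su andbT -lee_fin -en; exact: debut_le.
    by rewrite ltNge (ltW ys).
  by apply: ex; apply: debut_le; split.
move=> aX.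
(* It suffices to find a range of levels [y] for which [X] stays above [y] between the entrance and
   [t]. A rational [y] in it and a rational [x] below then exclude an exit before [t], and right
   continuity excludes one at [t]. *)
suff [y0 [y1 [p [ay0 y01 y1X p0 Hp]]]] : exists y0 y1 : R, exists p : rat,
    [/\ a <= y0, y0 < y1, y1 <= X t w,
    0 <= ratr p :> R & forall y, y0 < y < y1 -> (entrance (ratr p) y w <= t%:E)%E /\
    forall s, (entrance (ratr p) y w < s%:E)%E -> s < t -> y < X s w].
  have /rat_in_itvoo[y] := y01; rewrite in_itv/= => /andP[y0y yy1].
  have ay := le_lt_trans ay0 y0y.
  have /rat_in_itvoo[x] := ay; rewrite in_itv/= => /andP[ax xy].
  have [|en Hs] := Hp (ratr y); first by rewrite y0y.
  exists x, y, p; split => //.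
  have [u tu H] := cadlag_right_gt t0 (lt_le_trans (lt_trans xy yy1) y1X).
  move=> ex.
  have : (exit (ratr p) (ratr y) (ratr x) w < u%:E)%E.
    by apply: le_lt_trans ex _; rewrite lte_fin.
  move=> /debut_ltP[s [es Xs] su].
  have [ts|st] := leP t s.
    by have := H s; rewrite ts su => /(_ isT); rewrite ltNge (ltW Xs).
  have := Hs s es st; rewrite ltNge => /negP; apply.
  exact: ltW (lt_trans Xs xy).
move: t0; rewrite le_eqVlt => /predU1P[t0|t0].
  exists a, (X t w), 0; rewrite -t0 rmorph0; split=> //; first by rewrite t0.
  move=> y /andP[ay yX]; split.
    by apply: debut_le; split.
  move=> s /(le_lt_trans (entrance_ge _ _ _)); rewrite lte_fin => s0 s0'.
  by move: (lt_trans s0 s0'); rewrite ltxx.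
have [p /andP[p0 pt] [[b ab H]|H]] := cadlag_left_split w a t0.
  have /rat_in_itvoo[q] := pt; rewrite in_itv/= => /andP[pq qt].
  exists a, (Num.min b (X t w)), q; split => //.
  - by rewrite lt_min ab.
  - by rewrite ge_min lexx orbT.
  - by rewrite (le_trans p0 (ltW pq)).
  move=> y /andP[ay]; rewrite lt_min => /andP[yb yX]; split.
    apply: le_trans (_ : (_ <= (ratr q)%:E)%E) _; last by rewrite lee_fin ltW.
    apply: debut_le; split=> //; apply: lt_trans yb _; apply: H.
    by rewrite (ltW pq).
  move=> s /(le_lt_trans (entrance_ge _ _ _)); rewrite lte_fin => qs st.
  by apply: lt_trans yb _; apply: H; rewrite st (ltW (lt_trans pq qs)).
have /rat_in_itvoo[b] := aX; rewrite in_itv/= => /andP[ab bX].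
have [p' /andP[pp' p't] H'] := H _ ab.
have /rat_in_itvoo[q] := p't; rewrite in_itv/= => /andP[pq qt].
exists (ratr b), (X t w), q; split=> //.
- exact: ltW.
- exact: le_trans p0 (le_trans pp' (ltW pq)).
move=> y /andP[by_ yX]; split.
  by apply: debut_le; split=> //; exact: ltW.
move=> s es st; exfalso; move: es; apply/negP; rewrite -leNgt.
apply: debut_ge => r [qr yr]; rewrite lee_fin.
apply: le_trans (ltW st) _; rewrite leNgt; apply/negP => rt.
have := H' r; rewrite rt (le_trans (ltW pq) qr) => /(_ isT).
by rewrite ltNge (ltW (lt_trans by_ yr)).
Qed.

End cadlag.

(** By [cadlag_gtP] the set where [X] exceeds [a] is a countable union of stochastic intervals from
    an entrance to the next exit, and half-lines generate the Borel sets. *)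
Lemma optional_sub_stopping (Y : set (set (R * Omega))) : sigma_algebra Dplus Y ->
  (forall T, wide_stopping_time T -> Y (Dplus `&` [set p | (T p.2 <= p.1%:E)%E])) ->
  optional G `<=` Y.
Proof.
move=> sY YT; apply: smallest_sub => // _ [X [B [Xc mB ->]]].
have [Y0 YD YU] := sY.
have YT' T : wide_stopping_time T -> Y (Dplus `&` [set p | ~ (T p.2 <= p.1%:E)%E]).
  move=> /YT/YD; congr Y; apply/seteqP; split=> p [Dp nT]; split=> //.
    by move=> Tp; exact: nT.
  by move=> [].
have YI A1 A2 : Y A1 -> Y A2 -> Y (Dplus `&` (A1 `&` A2)).
  move=> Y1 Y2; rewrite (_ : A1 `&` A2 = \bigcap_n (if n is 0%N then A1 else A2)).
    by apply: sigma_algebra_setIbigcap => // -[].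
  apply/seteqP; split=> [p [A1p A2p] [|n] _//|p H].
  by split; [exact: (H 0%N I)|exact: (H 1%N I)].
have {}mB : (@ocitv R).-sigma.-measurable B := mB.
move: B mB; rewrite RGenOInfty.measurableE.
pose Z := [set B : set R | Y (Dplus `&` [set p | B (X p.1 p.2)])].
suff : <<s @RGenOInfty.G R >> `<=` Z by exact.
apply: smallest_sub.
  split.
  - by rewrite /Z/= (_ : [set _ | _] = set0) ?setI0.
  - move=> B /YD; congr Y; rewrite setTD; apply/seteqP; split=> p [Dp nT]; split=> //.
      by move=> Tp; exact: nT.
    by move=> [].
  - move=> B YB; rewrite /Z/= (_ : _ `&` _ = \bigcup_n (Dplus `&` [set p | B n (X p.1 p.2)])).
      exact: YU.
    by rewrite -setI_bigcupr; congr (_ `&` _); apply/seteqP; split=> p [n _ Bn]; exists n.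
move=> _ [a ->]; rewrite /Z/=.
rewrite (_ : _ `&` _ = \bigcup_n (if @unpickle (rat * rat * rat)%type n is Some (x, y, p) then
  (if [&& a < ratr x, ratr x < ratr y :> R & 0 <= ratr p :> R] then
     Dplus `&` ((Dplus `&` [set z | (entrance X (ratr p) (ratr y) z.2 <= z.1%:E)%E]) `&`
     (Dplus `&` [set z | ~ (exit X (ratr p) (ratr y) (ratr x) z.2 <= z.1%:E)%E]))
   else set0) else set0)).
  apply: YU => n; case: unpickle => [[[x y] p]|//]; case: ifP => // /and3P[ax xy p0].
  apply: YI; first exact/YT/wide_stopping_entrance.
  exact/YT'/wide_stopping_exit.
apply/seteqP; split=> [[t w] [t0 /=]|[t w] [n _]].
  rewrite in_itv/= andbT => /(cadlag_gtP Xc _ _ t0)[x [y [p [ax xy p0 en ex]]]].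
  exists (pickle (x, y, p)); first exact: I.
  by rewrite pickleK ax xy p0.
case: unpickle => [[[x y] p]|//]; case: ifP => // /and3P[ax xy p0].
move=> [t0 [[_ /= en] [_ /= ex]]]; split=> //=; rewrite in_itv/= andbT.
by apply/(cadlag_gtP Xc _ _ t0); exists x, y, p.
Qed.

End optional_generation.

(** * The law of the random times *)

(** Both sides are countably additive and agree on a generating pi-system; finiteness of [M] permits
    the subtraction for complements. *)
Lemma density_unique (d : measure_display) (T : measurableType d) (R : realType)
    (M : probability T R) (mu : {measure set T -> \bar R}) (g : T -> \bar R)
    (C : set (set T)) :
  @measurable _ T = <<s C >> -> setI_closed C -> C setT ->
  measurable_fun setT g -> (forall x, (0 <= g x)%E) ->
  (forall A, C A -> M A = \int[mu]_(x in A) g x)%E ->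
  forall A, measurable A -> (M A = \int[mu]_(x in A) g x)%E.
Proof.
move=> CE CI CT mg g0 CM A; rewrite CE; move: A.
apply: (dynkin_induction CE CI) => //.
- exact: CM.
- move=> S mS MS.
  have gS B : measurable_fun B g by exact: measurable_funS mg.
  have : (M S + M (~` S) = \int[mu]_(x in S) g x + \int[mu]_(x in ~` S) g x)%E.
    rewrite -ge0_integral_setU//; [|exact: measurableC|by rewrite disj_set2E setICr].
    by rewrite -measureU//; [rewrite setUv; exact: CM|exact: measurableC|exact: setICr].
  have fS : M S \is a fin_num by rewrite fin_num_measure.
  rewrite -MS => H; rewrite -[LHS](addeK _ fS) [X in (X - _)%E]addeC H.
  by rewrite [X in (X - _)%E]addeC addeK.
- move=> F mF tF MF.
  rewrite ge0_integral_bigcup//; last exact: measurable_funS mg.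
  rewrite measure_semi_bigcup//; last exact: bigcupT_measurable.
  by apply: eq_eseriesr => n _; exact: MF.
Qed.

Section image_probability.
Context {d d' : measure_display} {T : measurableType d} {T' : measurableType d'}
  {R : realType}.
Variables (P : probability T R) (f : T -> T').
Hypothesis mf : measurable_fun setT f.

Definition image_probability : probability T' R :=
  distribution P (mfun_Sub (mem_set mf) : {mfun T >-> T'}).

Lemma image_probabilityE A : image_probability A = P (f @^-1` A).
Proof. by []. Qed.

Lemma integral_image_probability D (g : T' -> \bar R) :
  measurable D -> measurable_fun D g -> (forall y, (0 <= g y)%E) ->
  (\int[image_probability]_(y in D) g y = \int[P]_(x in f @^-1` D) g (f x))%E.
Proof.
move=> mD mg g0; rewrite ge0_integral_pushforward//.
Qed.

End image_probability.

Section finite_sum.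
Context {d : measure_display} {T : measurableType d} {R : realType}.
Variables (P : nat -> probability T R) (n : nat).

Let fin_sum : fin_num_fun (msum P n).
Proof. by move=> A mA; rewrite /msum; apply/sum_fin_numP => i _ _; exact: fin_num_measure. Qed.

HB.instance Definition _ := @Measure_isFinite.Build _ T R (msum P n) fin_sum.

Definition finite_sum_measure : {finite_measure set T -> \bar R} := msum P n.

End finite_sum.

(** * The space of vectors and the iterated integral *)

Section vectors.
Context {R : realType} {m : nat}.

Definition cylinders : set (set ('I_m -> \bar R)) :=
  [set A | exists (j : 'I_m) (B : set (\bar R)), measurable B /\ A = [set v | B (v j)]].

(** The product sigma-algebra on all vectors, without sign constraint; [Bm] is its trace on
    [nonnegvec]. *)
Definition vec := g_sigma_algebraType cylinders.

Lemma measurable_coord (j : 'I_m) : measurable_fun setT (fun v : vec => v j).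
Proof.
move=> _ B mB; rewrite setTI; apply: sub_sigma_algebra.
by exists j, B.
Qed.

Lemma measurable_vec (d : measure_display) (T : measurableType d) (f : T -> vec) :
  (forall j, measurable_fun setT (fun x => f x j)) -> measurable_fun setT f.
Proof.
move=> mf; apply: (@measurability _ _ T vec setT f cylinders) => //.
move=> _ [_ [j [B [mB ->]]] <-]; exact: mf.
Qed.

Lemma measurable_nonnegvec : measurable (nonnegvec m : set vec).
Proof.
rewrite (_ : nonnegvec m = \bigcap_(j : 'I_m) [set v | (0 <= v j)%E]); last first.
  by apply/seteqP; split=> [v H j _|v H j]; [exact: H|exact: (H j I)].
apply: fin_bigcap_measurable => // j _.
have := emeasurable_fun_c_infty measurableT (measurable_coord j) 0%E.
by rewrite setTI.
Qed.

Lemma Bm_measurable (A : set vec) : Bm m A -> measurable A.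
Proof.
move: A; apply: smallest_sub.
  split=> //; first by move=> A mA; apply: measurableD => //; exact: measurable_nonnegvec.
  by move=> A mA; exact: bigcupT_measurable.
move=> _ [j [B [mB ->]]]; apply: measurableI; first exact: measurable_nonnegvec.
by have := @measurable_coord j measurableT B mB; rewrite setTI.
Qed.

Lemma measurable_Bm (A : set vec) : measurable A -> Bm m (nonnegvec m `&` A).
Proof.
move: A; apply: smallest_sub.
  split.
  - by rewrite /= setI0; exact: sigma_algebra0.
  - move=> A /sigma_algebraCD; congr (<<s _, _ >> _).
    by rewrite setTD setDE setCI setIUr setICr set0U.
  - move=> A mA; rewrite /= setI_bigcupr.
    by have [_ _] := smallest_sigma_algebra (nonnegvec m) [set A | exists (j : 'I_m) (B : set (\bar R)),
      measurable B /\ A = nonnegvec m `&` [set v | B (v j)]]; apply.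
move=> _ [j [B [mB ->]]]; apply: sub_sigma_algebra; by exists j, B.
Qed.

Lemma measurable_setc (j : 'I_m) :
  measurable_fun setT (fun p : vec * \bar R => setc m p.1 j p.2 : vec).
Proof.
apply: measurable_vec => k; rewrite /setc.
case: eqP => _; first exact: measurable_snd.
exact: (measurableT_comp (measurable_coord k) measurable_fst).
Qed.

Lemma iter_int_rcons (mu : {measure set \bar R -> \bar R}) l j f v :
  iter_int m mu (rcons l j) f v =
  iter_int m mu l (fun v' => \int[mu]_x f (setc m v' j x))%E v.
Proof.
elim: l v => //= i l IH v; apply: eq_integral => x _; exact: IH.
Qed.

(** The measure [nu] is the law of [v0] after its coordinates in [l] are replaced by independent
    draws from [mu]. The induction runs from the end of [l], whose last integral is the innermost
    one, and Tonelli joins it to the others. *)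
Lemma iter_int_measure (mu : probability (\bar R) R) (l : seq 'I_m) (v0 : vec) :
  exists nu : probability vec R, forall f : vec -> \bar R,
    measurable_fun setT f -> (forall v, (0 <= f v)%E) ->
    iter_int m mu l f v0 = (\int[nu]_v f v)%E.
Proof.
elim/last_ind: l => [|l j [nu IH]].
  exists (dirac v0 : probability vec R) => f mf f0 /=.
  by rewrite integral_dirac// diracT mul1e.
exists (image_probability (nu \x mu)%E (measurable_setc j)) => f mf f0.
rewrite integral_image_probability// iter_int_rcons.
have mfs : measurable_fun setT (fun p : vec * \bar R => f (setc m p.1 j p.2)).
  exact: (measurableT_comp mf (measurable_setc j)).
rewrite preimage_setT fubini_tonelli1// IH//.
- exact: (measurable_fun_fubini_tonelli_F (m2 := mu) _ mfs (fun=> f0 _)).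
- by move=> v; exact: integral_ge0.
Qed.

End vectors.

(** * Absolute continuity of the joint law *)

Section density.
Context {d : measure_display} {Omega : measurableType d} {R : realType} {m : nat}.
Variables (Q : probability Omega R) (F : R -> set (set Omega)).
Variable tau : nat -> Omega -> \bar R.
Hypothesis Fm : forall t, 0 <= t -> F t `<=` measurable.
Hypothesis mtau : forall j, (j < m)%N -> measurable_fun setT (tau j).
Hypothesis tau0 : forall j w, (j < m)%N -> (0 <= tau j w)%E.

Definition Fgen : set (set Omega) := [set A | exists t, 0 <= t /\ F t A].
(** The product space is built over [Finfty F], so that its null sets pull back to events generated
    by [Finfty F] and the times. *)
Definition OmegaF := g_sigma_algebraType Fgen.

Lemma Finfty_measurable : Finfty F `<=` measurable.
Proof.
apply: smallest_sub; first exact: sigma_algebra_measurable.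
by move=> A [t [t0 /(Fm t0)]].
Qed.

Lemma measurable_idF : measurable_fun setT (id : Omega -> OmegaF).
Proof. by move=> _ A mA; rewrite setTI; exact: Finfty_measurable. Qed.

Definition QF : probability OmegaF R := image_probability Q measurable_idF.

Definition tauvec (w : Omega) : @vec R m := fun j : 'I_m => tau j w.

Lemma measurable_tauvec : measurable_fun setT tauvec.
Proof. by apply: measurable_vec => j; exact: mtau. Qed.

Lemma measurable_graph : measurable_fun setT (fun w => (tauvec w, w) : @vec R m * OmegaF).
Proof. exact: measurable_fun_pair measurable_tauvec measurable_idF. Qed.

Lemma prod_sig_measurable (A : set (@vec R m * OmegaF)) :
  prod_sig m setT (Finfty F) A -> measurable A.
Proof.
move: A; apply: smallest_sub.
  split=> //.
    move=> A mA; apply: measurableD => //; apply: measurableX => //.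
    exact: measurable_nonnegvec.
  by move=> A mA; exact: bigcupT_measurable.
move=> _ [A mA [B mB <-]]; apply: measurableX => //; exact: Bm_measurable.
Qed.

Hypothesis dens : density_hyp Q F m tau.

(** On rectangles the density hypothesis says that the law of [(tauvec w, w)] has density [gamma]
    with respect to [nu] times [QF]; [density_unique] extends this to all measurable sets. *)
Lemma density_absolutely_continuous : exists nu : probability (@vec R m) R,
  forall S : set (@vec R m * OmegaF), measurable S -> (nu \x^ QF)%E S = 0%E ->
    Q [set w | S (tauvec w, w)] = 0%E.
Proof.
have [mu [gamma [_ g0 mg dE]]] := dens.
have [nu nuE] := iter_int_measure mu (enum 'I_m) (fun=> 0%E).
exists nu.
pose NN : set (@vec R m * OmegaF) := nonnegvec m `*` setT.
have mNN : measurable NN by apply: measurableX => //; exact: measurable_nonnegvec.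
(* Measurability of [gamma] is given on nonnegative vectors only, so it is extended by zero. *)
pose g : @vec R m * OmegaF -> \bar R := (EFin \o gamma) \_ NN.
have mgN : measurable_fun NN (gamma : @vec R m * OmegaF -> R).
  move=> _ B mB; exact: prod_sig_measurable (mg B mB).
have mgg : measurable_fun setT g.
  by apply/(measurable_restrictT _ mNN); exact/measurable_EFinP.
have gg0 p : (0 <= g p)%E by rewrite /g patchE; case: ifP => // _; rewrite lee_fin.
pose L := image_probability Q measurable_graph.
pose C := [set A `*` B | A in @measurable _ (@vec R m) & B in @measurable _ OmegaF].
have LE : forall S, measurable S -> (L S = \int[nu \x QF]_(p in S) g p)%E.
  apply: (@density_unique _ _ _ _ _ _ C) => //.
  - exact: measurable_prod_measurableType.
  - move=> _ _ [A1 mA1 [B1 mB1 <-]] [A2 mA2 [B2 mB2 <-]].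
    exists (A1 `&` A2); first exact: measurableI.
    by exists (B1 `&` B2); [exact: measurableI|rewrite setXI].
  - by exists setT => //; exists setT => //; rewrite setXTT.
  - move=> _ [A mA [B mB <-]].
    have mgAB : measurable_fun setT (g \_ (A `*` B)).
      by apply/(measurable_restrictT _ (measurableX mA mB)); exact: measurable_funS mgg.
    rewrite integral_mkcond fubini_tonelli2//; last first.
      by move=> p; rewrite patchE; case: ifP.
    transitivity (Q (B `&` [set w | (nonnegvec m `&` A) (fun j : 'I_m => tau j w)])).
      rewrite /L image_probabilityE; congr (Q _); apply/seteqP; split=> w /=.
        by move=> [Aw Bw]; split=> //; split=> // j; exact: tau0.
      by move=> [Bw [_ Aw]].
    rewrite dE//; [|exact: measurable_Bm].
    pose h := fubini_G nu (g \_ (A `*` B)).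
    have gAB0 p : (0 <= (g \_ (A `*` B)) p)%E by rewrite patchE; case: ifP.
    have mh : measurable_fun setT h by exact: measurable_fun_fubini_tonelli_G.
    have h0 w : (0 <= h w)%E by exact: integral_ge0.
    transitivity (\int[QF]_(w in B) h w)%E; last first.
      rewrite integral_mkcond; apply: eq_integral => w _; rewrite patchE.
      case: ifPn => // wB; rewrite /h /fubini_G integral0_eq// => v _.
      by rewrite patchE memNset// => -[_ /= Bw]; rewrite mem_set in wB.
    rewrite (integral_image_probability Q measurable_idF mB (measurable_funS measurableT _ mh) h0)//.
    apply: eq_integral => w; rewrite inE => Bw.
    rewrite /prod_int (_ : (fun v => _) = (fun v => (g \_ (A `*` B)) (v, w))).
      rewrite nuE//.
      exact: (measurable_fun_pair1 (w : OmegaF) mgAB).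
    apply/funext => v; rewrite /g !patchE indicE.
    have [vNA|vNA] := boolP (v \in nonnegvec m `&` A).
      move: vNA; rewrite inE => -[vN vA].
      by rewrite mem_set ?mul1e ?mem_set.
    rewrite mul0e; case: ifPn => // /set_mem[vA _].
    by case: ifPn => // /set_mem[vN _]; rewrite mem_set in vNA.
move=> S mS S0.
have -> : Q [set w | S (tauvec w, w)] = L S by [].
rewrite LE//; apply: null_set_integral => //; first exact: measurable_funS mgg.
(* The two orders of integration define the same measure, as they agree on rectangles. *)
rewrite -S0; apply: product_measure_unique => // A B mA mB.
exact: product_measure2E.
Qed.

End density.

(** * Events of the enlarged filtration *)

Section enlargement.
Context {d : measure_display} {Omega : measurableType d} {R : realType} {m : nat}.
Variables (Q : probability Omega R) (F : R -> set (set Omega)).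
Variable tau : nat -> Omega -> \bar R.
Hypothesis FS : forall t, 0 <= t -> sigma_algebra setT (F t).
Hypothesis Fm : forall t, 0 <= t -> F t `<=` measurable.
Hypothesis Fnd : forall s t, 0 <= s -> s <= t -> F s `<=` F t.
Hypothesis mtau : forall j, (j < m)%N -> measurable_fun setT (tau j).

Definition tau_sig (k : nat) : set (set Omega) :=
  <<s Finfty F `|` [set A | exists2 j, (j < k)%N & sigma_of (tau j) A] >>.

Lemma tau_sig_measurable : tau_sig m `<=` measurable.
Proof.
apply: smallest_sub; first exact: sigma_algebra_measurable.
move=> A [/(Finfty_measurable Fm)//|[j jm [B mB <-]]].
by have := mtau jm measurableT mB; rewrite setTI.
Qed.

(** The covering null set has to lie in [tau_sig m], as for the generators of [Nk] at [m]. *)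
Definition tau_null (N : set Omega) := exists M, [/\ tau_sig m M, Q M = 0%E & N `<=` M].

Lemma tau_null0 : tau_null set0.
Proof. by exists set0; split=> //; exact: sigma_algebra0. Qed.

Lemma tau_nullS N N' : N' `<=` N -> tau_null N -> tau_null N'.
Proof. by move=> NN' [M [TM QM NM]]; exists M; split=> //; exact: subset_trans NM. Qed.

Lemma tau_null_bigcup (N : nat -> set Omega) :
  (forall n, tau_null (N n)) -> tau_null (\bigcup_n N n).
Proof.
move=> /choice[M HM]; exists (\bigcup_n M n).
have TM n : tau_sig m (M n) by have [] := HM n.
split.
- by have [_ _] := smallest_sigma_algebra setT (Finfty F `|`
    [set A | exists2 j, (j < m)%N & sigma_of (tau j) A]); apply.
- apply: measure_negligible.
    by apply: bigcupT_measurable => n; exact: tau_sig_measurable.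
  apply: negligible_bigcup => n; have [_ QM _] := HM n.
  by apply/negligibleP => //; exact: tau_sig_measurable.
- by apply: subset_bigcup => n _; have [] := HM n.
Qed.

Lemma tau_nullU N N' : tau_null N -> tau_null N' -> tau_null (N `|` N').
Proof.
move=> H H'; apply: (@tau_nullS (\bigcup_n (if n is 0%N then N else N'))).
  by move=> w [Nw|Nw]; [exists 0%N|exists 1%N].
by apply: tau_null_bigcup => -[].
Qed.

Lemma tau_null_Nk N : tau_null N -> Nk Q F tau m N.
Proof.
move=> [M [TM QM NM]]; apply: sub_sigma_algebra; exists M; split=> //; split=> //.
exact: tau_sig_measurable.
Qed.

Lemma tau_sig_le k l : (k <= l)%N -> tau_sig k `<=` tau_sig l.
Proof.
move=> kl; apply: sub_smallest2r; first exact: smallest_sigma_algebra.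
by move=> A [?|[j jk ?]]; [left|right; exists j => //; exact: leq_trans kl].
Qed.

(* The filtration progressively enlarged by the coordinates of the product space, free of
   null sets: events of [B^m (x) F_s] that only depend on [v] through [v /\ s]. *)
Definition stopped_cylinder (s : R) (A : set (@vec R m * Omega)) :=
  @measurable _ (@vec R m * g_sigma_algebraType (F s))%type A /\
  forall v v' w, (forall j, Order.min (v j) s%:E = Order.min (v' j) s%:E) ->
    A (v, w) -> A (v', w).

Lemma stopped_cylinderC s A : stopped_cylinder s A -> stopped_cylinder s (~` A).
Proof.
move=> [mA iA]; split; first exact: measurableC.
by move=> v v' w vv' nA A'; apply: nA; apply: iA A' => j; rewrite vv'.
Qed.

Lemma stopped_cylinderU s (A : nat -> set (@vec R m * Omega)) :
  (forall n, stopped_cylinder s (A n)) -> stopped_cylinder s (\bigcup_n A n).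
Proof.
move=> HA; split; first by apply: bigcupT_measurable => n; have [] := HA n.
move=> v v' w vv' [n _ An]; exists n => //.
by have [_ /(_ v v' w vv' An)] := HA n.
Qed.

Lemma stopped_cylinderI s (A : nat -> set (@vec R m * Omega)) :
  (forall n, stopped_cylinder s (A n)) -> stopped_cylinder s (\bigcap_n A n).
Proof.
move=> HA; rewrite -[X in stopped_cylinder _ X]setCK setC_bigcap.
by apply/stopped_cylinderC/stopped_cylinderU => n; exact: stopped_cylinderC.
Qed.

(** A single [Ah] serves every [s > t], which makes it an event of the right limit at [t] of the
    filtration on the product space. *)
Definition represented (t : R) (A : set Omega) := exists Ah,
  (forall s, t < s -> stopped_cylinder s Ah) /\
  tau_null [set w | ~ (A w <-> Ah (tauvec tau w, w))].

Lemma represented_sigma_algebra t : sigma_algebra setT (represented t).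
Proof.
split.
- exists set0; split=> // ; apply: tau_nullS tau_null0 => w /=; apply; split=> //.
- move=> A [Ah [HA NA]]; exists (~` Ah); split.
    by move=> s ts; exact/stopped_cylinderC/HA.
  apply: tau_nullS NA => w /=; apply: contra_not => H.
  split=> [[_ nA] /H//|nAh]; split=> // /H.
  exact: nAh.
- move=> A /choice[Ah HA]; exists (\bigcup_n Ah n); split.
    by move=> s ts; apply: stopped_cylinderU => n; have [+ _] := HA n; exact.
  have : tau_null (\bigcup_n [set w | ~ (A n w <-> Ah n (tauvec tau w, w))]).
    by apply: tau_null_bigcup => n; have [] := HA n.
  apply: tau_nullS => w /=; apply: contra_notP => H.
  have HH n : A n w <-> Ah n (tauvec tau w, w).
    by apply: contrapT => nH; apply: H; exists n.
  by split=> -[n _ /HH]; exists n.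
Qed.

Lemma F_represented t A : 0 <= t -> F t A -> represented t A.
Proof.
move=> t0 FA; exists [set p | A p.2]; split.
  move=> s ts; split=> //.
  rewrite (_ : [set _ | _] = setT `*` A); last by apply/seteqP; split=> p //= [].
  apply: measurableX => //; apply: sub_sigma_algebra; exact: Fnd (ltW ts) _ FA.
by apply: tau_nullS tau_null0 => w /=; apply.
Qed.

(** The generators lie in null sets and are represented by the empty set; the represented events
    form a sigma-algebra. *)
Lemma null_represented t k A : (k <= m)%N -> Nk Q F tau k A -> represented t A.
Proof.
move=> km; move: A; apply: smallest_sub; first exact: represented_sigma_algebra.
move=> N [M [TM [mM [QM NM]]]]; exists set0; split=> //.
exists M; split=> //; first exact: tau_sig_le TM.
by move=> w /=; apply: contra_notP => nM; split=> // /NM.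
Qed.

Lemma min_sig_represented t k A : (k < m)%N ->
  sigma_of (fun w => Order.min (tau k w) t%:E) A -> represented t A.
Proof.
move=> km [B mB <-]; exists [set p | B (Order.min (p.1 (Ordinal km)) t%:E)]; split.
  move=> s ts; split.
    rewrite (_ : [set _ | _] = [set v | B (Order.min (v (Ordinal km)) t%:E)] `*` setT).
      apply: measurableX => //.
      have mf : measurable_fun setT (fun v : @vec R m => Order.min (v (Ordinal km)) t%:E).
        apply: measurable_mine => //; exact: measurable_coord.
      by have := mf measurableT B mB; rewrite setTI.
    by apply/seteqP; split=> p //= [].
  move=> v v' w /(_ (Ordinal km)) vv' /=.
  have ms x : Order.min x t%:E = Order.min (Order.min x s%:E) t%:E.
    by rewrite -minA [X in _ = Order.min _ X]min_r// lee_fin ltW.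
  by rewrite ms vv' -ms.
by apply: tau_nullS tau_null0 => w /=; apply.
Qed.

(* A set known at every time [t + 1/n] is represented by the upper limit of its
   representatives at these times. *)
Lemma right_limit_represented t A :
  (forall s, t < s -> represented s A) -> represented t A.
Proof.
move=> HA; pose u n : R := t + n.+1%:R^-1.
have tu n : t < u n by rewrite ltrDl.
have /choice[Ah HAh] := fun n => HA _ (tu n).
exists (lim_sup_set Ah); split.
  move=> s ts.
  have st : 0 < s - t by rewrite subr_gt0.
  have [n0 _ Hn0] := near_infty_natSinv_lt (PosNum st).
  (* Dropping the first [n0] terms leaves the upper limit unchanged, and all remaining times [u n]
     lie before [s]. *)
  have -> : lim_sup_set Ah = \bigcap_n \bigcup_k Ah (n + n0 + k)%N.
    apply/seteqP; split=> p Hp n _.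
      have [j /= nj Aj] := Hp (n + n0)%N I.
      by exists (j - (n + n0))%N => //; rewrite subnKC.
    have [k _ Ak] := Hp n I; exists (n + n0 + k)%N => //=.
    by rewrite -addnA leq_addr.
  apply: stopped_cylinderI => n; apply: stopped_cylinderU => k.
  have [+ _] := HAh (n + n0 + k)%N; apply; rewrite /u -ltrBrDl.
  by apply: Hn0 => /=; rewrite addnAC leq_addl.
have : tau_null (\bigcup_n [set w | ~ (A w <-> Ah n (tauvec tau w, w))]).
  by apply: tau_null_bigcup => n; have [] := HAh n.
apply: tau_nullS => w /=; apply: contra_notP => H.
have HH n : A w <-> Ah n (tauvec tau w, w).
  by apply: contrapT => nH; apply: H; exists n.
split=> [Aw n _|/(_ 0%N I)[n _ /HH//]].
by exists n => //=; exact/HH.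
Qed.

(** By induction on [k]: every ingredient of the enlargement is represented, and generating a
    sigma-algebra or taking right limits preserves this. *)
Lemma Gk_represented k t : (k <= m)%N -> 0 <= t -> Gk Q F tau k t `<=` represented t.
Proof.
elim: k t => [|k IH] t km t0 A; first exact: F_represented.
move: A; apply: smallest_sub; first exact: represented_sigma_algebra.
move=> A [|HA]; first exact: null_represented.
apply: right_limit_represented => s ts.
have := HA s ts; move: A {HA}; apply: smallest_sub; first exact: represented_sigma_algebra.
have s0 := le_trans t0 (ltW ts).
move=> A [|]; first exact: IH (ltnW km) s0 _.
exact: min_sig_represented.
Qed.

Lemma Gk_sigma_algebra k t : 0 <= t -> sigma_algebra setT (Gk Q F tau k t).
Proof. by case: k => [/FS//|k _]; exact: smallest_sigma_algebra. Qed.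

Lemma Gk_ndecr k s t : 0 <= s -> s <= t -> Gk Q F tau k s `<=` Gk Q F tau k t.
Proof.
case: k => [|k] s0 st; first exact: Fnd.
apply: sub_smallest2r; first exact: smallest_sigma_algebra.
by move=> A [|HA]; [left|right=> u tu; apply: HA; exact: le_lt_trans tu].
Qed.

(** [Th] is the infimum of the positive rational levels [q] such that the representative of [T < q]
    contains the point. The levels being countable, one null set collects all exceptions. *)
Lemma stopping_time_represented (T : Omega -> \bar R) :
  wide_stopping_time (Gk Q F tau m) T ->
  exists Th : @vec R m * Omega -> \bar R,
  [/\ forall p, (0 <= Th p)%E,
      forall s, 0 < s -> stopped_cylinder s [set p | (Th p < s%:E)%E] &
      tau_null [set w | T w <> Th (tauvec tau w, w)]].
Proof.
move=> [T0 TG].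
pose q n : R := if @unpickle rat n is Some r then ratr r else 0.
have /choice[Ah HAh] : forall n, exists Ah, 0 < q n ->
    (forall s, q n < s -> stopped_cylinder s Ah) /\
    tau_null [set w | ~ ((T w < (q n)%:E)%E <-> Ah (tauvec tau w, w))].
  move=> n; have [q0|q0] := ltP 0 (q n); last by exists set0.
  by have [Ah HAh] := Gk_represented (leqnn m) (ltW q0) (TG _ q0); exists Ah.
pose Th p := ereal_inf [set (q n)%:E | n in [set n | 0 < q n /\ Ah n p]].
exists Th; split.
- by move=> p; apply: le_ereal_inf_tmp => _ [n [q0 _] <-]; rewrite lee_fin ltW.
- move=> s s0.
  rewrite (_ : [set _ | _] = \bigcup_n (if (0 < q n) && (q n < s) then Ah n else set0)).
    apply: stopped_cylinderU => n; case: ifP => // /andP[q0 qs].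
    by have [+ _] := HAh n q0; apply.
  apply/seteqP; split=> p /=.
    move=> /ereal_inf_lt[_ [n [q0 An] <-]]; rewrite lte_fin => qs.
    by exists n => //; rewrite q0 qs.
  move=> [n _]; case: ifP => // /andP[q0 qs] An.
  apply: le_lt_trans (_ : (_ <= (q n)%:E)%E) _; last by rewrite lte_fin.
  by apply: ereal_inf_lbound; exists n.
have : tau_null (\bigcup_n [set w | 0 < q n /\ ~ ((T w < (q n)%:E)%E <-> Ah n (tauvec tau w, w))]).
  apply: tau_null_bigcup => n; have [q0|q0] := ltP 0 (q n); last first.
    by apply: tau_nullS tau_null0 => w [].
  by have [_] := HAh n q0; apply: tau_nullS => w [].
apply: tau_nullS => w /=; apply: contra_notP => H.
have HH n : 0 < q n -> (T w < (q n)%:E)%E <-> Ah n (tauvec tau w, w).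
  by move=> q0; apply: contrapT => nH; apply: H; exists n.
apply/eqP; rewrite eq_le; apply/andP; split.
  by apply: le_ereal_inf_tmp => _ [n [q0 /(HH _ q0)/ltW]] + <-.
move: (T0 w) HH; case: (T w) => [x x0 HH| _ _|//]; last by rewrite leey.
apply/lee_addgt0Pr => e e0.
have /rat_in_itvoo[r] : x < x + e by rewrite ltrDl.
rewrite in_itv/= => /andP[xr re].
have qr : q (pickle r) = ratr r by rewrite /q pickleK.
apply: le_trans (_ : (_ <= (q (pickle r))%:E)%E) _; last first.
  by rewrite qr -EFinD lee_fin ltW.
have q0 : 0 < q (pickle r) by rewrite qr (le_lt_trans _ xr)// -lee_fin.
apply: ereal_inf_lbound; exists (pickle r) => //=; split=> //.
by apply/HH => //; rewrite qr lte_fin.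
Qed.

End enlargement.

(** * Splitting at the observed times *)

Section masks.
Context {R : realType} {m : nat}.

Definition mask (I : {set 'I_m}) (v : @vec R m) : @vec R m :=
  fun j => if j \in I then v j else +oo%E.

Lemma measurable_mask I : measurable_fun setT (mask I).
Proof.
apply: measurable_vec => j; rewrite /mask; case: (j \in I) => //.
exact: measurable_coord.
Qed.

Variable nu : probability (@vec R m) R.

(* At time [t] the coordinates of the times still to come read [+oo], so null sets have to
   be null for the images of [nu] under all partial replacements by [+oo]. *)
Definition masked_measure : {finite_measure set (@vec R m) -> \bar R} :=
  finite_sum_measure
    (fun i => image_probability nu (measurable_mask (nth finset.set0 (enum {set 'I_m}) i)))
    #|{set 'I_m}|.

Lemma masked_measure_ge I A : measurable A -> (nu (mask I @^-1` A) <= masked_measure A)%E.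
Proof.
move=> mA; rewrite /masked_measure /= /msum/=.
have iI : (index I (enum {set 'I_m}) < #|{set 'I_m}|)%N.
  by rewrite cardE index_mem mem_enum.
rewrite (bigD1 (Ordinal iI))//= nth_index ?mem_enum//.
by apply: leeDl; apply: sume_ge0 => i _.
Qed.

Lemma measurable_mask_slice (d : measure_display) (T : measurableType d)
    (S : set (@vec R m * T)) I : measurable S ->
  measurable [set p : @vec R m * T | S (mask I p.1, p.2)].
Proof.
move=> mS.
have mf : measurable_fun setT (fun p : @vec R m * T => (mask I p.1, p.2)).
  apply: measurable_fun_pair; last exact: measurable_snd.
  exact: (measurableT_comp (measurable_mask I) measurable_fst).
by have := mf measurableT S mS; rewrite setTI.
Qed.

(** Each image of [nu] is one term of the sum [masked_measure], so the slices are compared and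
    integrated over [w]. *)
Lemma masked_null (d : measure_display) (T : measurableType d) (P : probability T R)
    (S : set (@vec R m * T)) I : measurable S -> (masked_measure \x^ P)%E S = 0%E ->
  (nu \x^ P)%E [set p | S (mask I p.1, p.2)] = 0%E.
Proof.
move=> mS S0; apply/eqP; rewrite eq_le; apply/andP; split; last exact: measure_ge0.
have mSI := measurable_mask_slice I mS.
rewrite -S0; apply: ge0_le_integral => //.
- exact: measurable_fun_ysection.
- exact: measurable_fun_ysection.
move=> w _ /=; rewrite !ysectionE; apply: (masked_measure_ge I).
by rewrite -ysectionE; exact: measurable_ysection.
Qed.

End masks.

Section splitting.
Context {d : measure_display} {Omega : measurableType d} {R : realType} {m : nat}.
Variables (Q : probability Omega R) (F : R -> set (set Omega)).
Variable tau : nat -> Omega -> \bar R.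
Hypothesis FS : forall t, 0 <= t -> sigma_algebra setT (F t).
Hypothesis Fm : forall t, 0 <= t -> F t `<=` measurable.
Hypothesis Fnd : forall s t, 0 <= s -> s <= t -> F s `<=` F t.
Hypothesis Frc : forall t, 0 <= t -> F t = [set A | forall s, t < s -> F s A].
Hypothesis mtau : forall j, (j < m)%N -> measurable_fun setT (tau j).
Hypothesis tau0 : forall j w, (j < m)%N -> (0 <= tau j w)%E.
Hypothesis dens : density_hyp Q F m tau.

Definition observed (t : R) (w : Omega) : @vec R m := fun j : 'I_m => nmid (tau j w) t%:E.

Definition seen (t : R) (w : Omega) : {set 'I_m} := [set j : 'I_m | (tau j w <= t%:E)%E].

Lemma observed_mask t w : observed t w = mask (seen t w) (tauvec tau w).
Proof. by apply/funext => j; rewrite /observed /nmid /mask /seen inE. Qed.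

Lemma observed_nonneg t w : nonnegvec m (observed t w).
Proof. by move=> j; rewrite /observed /nmid; case: ifP => // _; exact: tau0. Qed.

(** Only finitely many times are still to come at [t], so some [u > t] precedes them all; stopped
    before [u], such a time reads the same as [+oo]. *)
Lemma observed_horizon t w : exists2 u : R, t < u & forall s, t < s < u -> forall j : 'I_m,
  Order.min (tau j w) s%:E = Order.min (observed t w j) s%:E.
Proof.
have [u tu H] : exists2 u : R, t < u &
    forall j : 'I_m, (t%:E < tau j w)%E -> (u%:E <= tau j w)%E.
  suff [u tu H] : exists2 u : R, t < u & forall j : 'I_m, j \in enum 'I_m ->
      (t%:E < tau j w)%E -> (u%:E <= tau j w)%E.
    by exists u => // j; apply: H; rewrite mem_enum.
  elim: (enum 'I_m) => [|j l [u tu IH]]; first by exists (t + 1) => //; rewrite ltrDl.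
  have [tj|jt] := ltP t%:E (tau j w); last first.
    by exists u => // k /predU1P[->|]; [rewrite ltNge jt|exact: IH].
  case tE : (tau j w) tj => [x| |//] tj.
    exists (Num.min u x); first by rewrite lt_min tu -lte_fin.
    move=> k /predU1P[->|kl tk]; first by rewrite tE lee_fin ge_min lexx orbT.
    by apply: le_trans (IH k kl tk); rewrite lee_fin ge_min lexx.
  exists u => // k /predU1P[->|kl tk]; first by rewrite tE leey.
  exact: IH.
exists u => // s /andP[ts su] j; rewrite /observed /nmid.
case: leP => // /H uj; rewrite !min_r ?leey//.
by apply: le_trans uj; rewrite lee_fin ltW.
Qed.

(** For [s] slightly above [t] both vectors agree after stopping at [s], so [Th < s] cannot tell
    them apart; then [s] decreases to [t]. *)
Lemma stopped_observed (Th : @vec R m * Omega -> \bar R) t w : 0 <= t ->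
  (forall s, 0 < s -> stopped_cylinder F s [set p | (Th p < s%:E)%E]) ->
  (Th (observed t w, w) <= t%:E)%E <-> (Th (tauvec tau w, w) <= t%:E)%E.
Proof.
move=> t0 HTh; have [u tu Hu] := observed_horizon t w.
have eqs s : t < s < u -> (Th (observed t w, w) < s%:E)%E <-> (Th (tauvec tau w, w) < s%:E)%E.
  move=> tsu; have [_ iT] := HTh s (le_lt_trans t0 (andP tsu).1).
  by split; apply: iT => j; rewrite (Hu s tsu j).
have key x y : (forall s, t < s < u -> (x < s%:E)%E -> (y < s%:E)%E) ->
    (x <= t%:E)%E -> (y <= t%:E)%E.
  move=> H xt; apply/lee_addgt0Pr => e e0.
  have /rat_in_itvoo[r] : t < Num.min u (t + e) by rewrite lt_min tu ltrDl.
  rewrite in_itv/= lt_min => /and3P[tr ru re].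
  apply: ltW; apply: lt_trans (_ : (y < (ratr r)%:E)%E) _; last by rewrite -EFinD lte_fin.
  by apply: H; rewrite ?tr//; apply: le_lt_trans xt _; rewrite lte_fin.
by split; apply: key => s /eqs; tauto.
Qed.

Definition split_set (D : set (R * Omega)) := exists Dh : set (@vec R m * (R * Omega)),
  prod_sig m Dplus (optional F) Dh /\ exists2 N, tau_null (m := m) Q F tau N &
  forall w, ~ N w -> forall t, 0 <= t -> D (t, w) <-> Dh (observed t w, (t, w)).

Lemma split_set_sigma_algebra : sigma_algebra Dplus split_set.
Proof.
have [_ sD sU] := smallest_sigma_algebra (nonnegvec m `*` Dplus : set (@vec R m * (R * Omega)))
  [set A `*` C | A in Bm m & C in optional F].
split.
- exists set0; split; first exact: sigma_algebra0.
  by exists set0; [exact: tau_null0|].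
- move=> D [Dh [mD [N nN HN]]]; exists (nonnegvec m `*` Dplus `\` Dh); split; first exact: sD.
  exists N => // w Nw t t0; split=> [[_ nD]|[_ nD]]; split=> //.
  + by split=> //; exact: observed_nonneg.
  + by move=> /(HN w Nw t t0).
  + by move=> /(HN w Nw t t0).
- move=> D /choice[Dh HD]; exists (\bigcup_n Dh n); split.
    by apply: sU => n; have [] := HD n.
  have /choice[N HN] : forall n, exists N, tau_null (m := m) Q F tau N /\
      forall w, ~ N w -> forall t, 0 <= t -> D n (t, w) <-> Dh n (observed t w, (t, w)).
    by move=> n; have [_ [N]] := HD n; exists N.
  exists (\bigcup_n N n).
    by apply: tau_null_bigcup => // n; have [] := HN n.
  move=> w nN t t0.
  have H n : D n (t, w) <-> Dh n (observed t w, (t, w)).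
    by have [_ ] := HN n; apply=> // Nn; apply: nN; exists n.
  by split=> -[n _ /H]; exists n.
Qed.

Lemma tau_sig_graph (S : set (@vec R m * OmegaF F)) : measurable S ->
  tau_sig F tau m [set w | S (tauvec tau w, w)].
Proof.
move=> mS; pose OT := g_sigma_algebraType (Finfty F `|`
  [set A | exists2 j, (j < m)%N & sigma_of (tau j) A]).
have mt : measurable_fun setT (tauvec tau : OT -> @vec R m).
  apply: measurable_vec => j _ B mB; rewrite setTI; apply: sub_sigma_algebra; right.
  by exists (nat_of_ord j) => //; exists B.
have mi : measurable_fun setT (id : OT -> OmegaF F).
  by move=> _ B mB; rewrite setTI; apply: sub_sigma_algebra; left.
by have := measurable_fun_pair mt mi measurableT mS; rewrite setTI.
Qed.

Lemma optional_prod_sig (E : set (@vec R m * (R * Omega))) :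
  <<s setT `*` Dplus, [set A `*` C | A in @measurable _ (@vec R m) & C in optional F] >> E ->
  prod_sig m Dplus (optional F) ((nonnegvec m `*` Dplus) `&` E).
Proof.
have [s0 sD sU] := smallest_sigma_algebra (nonnegvec m `*` Dplus : set (@vec R m * (R * Omega)))
  [set A `*` C | A in Bm m & C in optional F].
move: E; apply: smallest_sub.
  split.
  - by rewrite /= setI0.
  - move=> E /sD; congr (<<s _, _ >> _); apply/seteqP; split=> p [Wp nE]; split=> //.
    + by split; [case: Wp|move=> Ep; apply: nE].
    + by move=> [_ Ep]; case: nE.
  - by move=> E HE; rewrite /= setI_bigcupr; exact: sU.
move=> _ [A mA [C oC <-]]; apply: sub_sigma_algebra.
exists (nonnegvec m `&` A); first exact: measurable_Bm.
exists (Dplus `&` C); last by rewrite setXI.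
by rewrite -setDD; apply: sigma_algebraCD; exact: sigma_algebraCD.
Qed.

Lemma stopping_split_set T : wide_stopping_time (Gk Q F tau m) T ->
  split_set (Dplus `&` [set p | (T p.2 <= p.1%:E)%E]).
Proof.
move=> wT; have [Th [Th0 HTh nTh]] := stopping_time_represented Fm Fnd mtau wT.
have [nu nuAC] := density_absolutely_continuous Fm mtau tau0 dens.
have FmF t : 0 <= t -> F t `<=` @measurable _ (OmegaF F).
  by move=> t0 A FA; apply: sub_sigma_algebra; exists t.
have mTh s : 0 < s -> @measurable _ (@vec R m * g_sigma_algebraType (F s))%type
    [set p | (Th p < s%:E)%E].
  by move=> /HTh[].
have [E [S [sE mS S0 ES]]] := @parametrized_stopping_time_optional _ _ (@vec R m) (OmegaF F) R
  (masked_measure nu) (QF Q Fm) F FS FmF Fnd Frc Th Th0 mTh.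
exists ((nonnegvec m `*` Dplus) `&` E); split.
  exact: optional_prod_sig.
(* The exceptional set must not depend on [t]. As [observed t w] is one of finitely many masks of
   the times, it is enough to pull [S] back along every mask. *)
pose SI I : set Omega := [set w | S (mask I (tauvec tau w), w)].
have nSI I : tau_null (m := m) Q F tau (SI I).
  have mSI := measurable_mask_slice I mS.
  exists (SI I); split=> //; first exact: (tau_sig_graph mSI).
  exact: nuAC mSI (masked_null I mS S0).
exists ([set w | T w <> Th (tauvec tau w, w)] `|`
  \bigcup_n SI (nth finset.set0 (enum {set 'I_m}) n)).
  by apply: tau_nullU => //; apply: tau_null_bigcup.
move=> w /not_orP[/contrapT TE nS] t t0.
have nSw : ~ S (observed t w, w).
  move=> Sw; apply: nS; exists (index (seen t w) (enum {set 'I_m})) => //.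
  by rewrite nth_index ?mem_enum// /SI/= -observed_mask.
have [EE1 EE2] := ES _ _ _ nSw t0.
have [sT1 sT2] := stopped_observed w t0 HTh.
split.
  move=> [_ /= Tt]; split; first by split=> //; exact: observed_nonneg.
  by apply/EE2/sT2; rewrite -TE.
move=> [_ /EE1/sT1 Tt]; split=> //=; by rewrite TE.
Qed.

Lemma optional_split_set : optional (Gk Q F tau m) `<=` split_set.
Proof.
apply: optional_sub_stopping.
- by move=> t; exact: Gk_sigma_algebra.
- by move=> s t; exact: Gk_ndecr.
- exact: split_set_sigma_algebra.
- exact: stopping_split_set.
Qed.

(** [Y] is the infimum of the rational levels above it; each set [Y < q] splits, and the split sets
    give back a function by the same infimum. *)
Lemma optional_process_split (Y : R * Omega -> R) :
  measurable_wrt Dplus (optional (Gk Q F tau m)) Y ->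
  exists Yh : @vec R m * (R * Omega) -> R,
  measurable_wrt (nonnegvec m `*` Dplus) (prod_sig m Dplus (optional F)) Yh /\
  exists2 N, tau_null (m := m) Q F tau N & forall w, ~ N w -> forall t, 0 <= t ->
    Y (t, w) = Yh (observed t w, (t, w)).
Proof.
move=> mY.
pose q n : R := if @unpickle rat n is Some r then ratr r else 0.
have /choice[Dh HD] : forall n, exists Dh : set (@vec R m * (R * Omega)),
    prod_sig m Dplus (optional F) Dh /\ exists2 N, tau_null (m := m) Q F tau N &
    forall w, ~ N w -> forall t, 0 <= t ->
      (Dplus `&` [set p | Y p < q n]) (t, w) <-> Dh (observed t w, (t, w)).
  move=> n; apply: optional_split_set.
  rewrite (_ : [set p | _] = Y @^-1` `]-oo, (q n)[%classic); first exact: mY.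
  by apply/seteqP; split=> p /=; rewrite in_itv.
pose W : set (@vec R m * (R * Omega)) := nonnegvec m `*` Dplus.
pose r x := ereal_inf [set (q n)%:E | n in [set n | Dh n x]].
have sW := smallest_sigma_algebra W [set A `*` C | A in Bm m & C in optional F].
(* [prod_sig] is a sigma-algebra on [W] only; the sets with trace in it form one on the whole space,
   where measurable functions are available. *)
pose SW := [set A | prod_sig m Dplus (optional F) (W `&` A)].
have sSW : sigma_algebra setT SW.
  have [s0 sD sU] := sW; split.
  - by rewrite /SW/= setI0.
  - move=> A /sD; rewrite /SW/=; congr (<<s _, _ >> _); apply/seteqP; split=> p [Wp nA].
      by split=> //; split=> // Ap; apply: nA.
    by split=> // -[_ Ap]; case: nA.
  - by move=> A HA; rewrite /SW/= setI_bigcupr; exact: sU.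
pose TW := g_sigma_algebraType SW.
have mTW A : @measurable _ TW A -> SW A.
  by rewrite /measurable/= (sigma_algebra_id sSW).
have SWM A : SW A -> @measurable _ TW A by exact: sub_sigma_algebra.
have SDh n : SW (Dh n).
  have [_ sD _] := sW; rewrite /SW/= -setDD; apply: (sD); apply: sD.
  by have [] := HD n.
have mr : measurable_fun setT (r : TW -> \bar R).
  apply: (@measurability _ _ TW (\bar R) setT r _ (ErealGenInftyO.measurableE R)).
  move=> _ [_ [x ->] <-]; rewrite setTI.
  rewrite (_ : r @^-1` _ = \bigcup_n (if q n < x then Dh n else set0)).
    by apply: bigcupT_measurable => n; case: ifP => // _; exact: SWM.
  apply/seteqP; split=> p /=; rewrite in_itv/=.
    by move=> /ereal_inf_lt[_ [n Dn <-]]; rewrite lte_fin => qx; exists n; rewrite ?qx.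
  move=> [n _]; case: ifP => // qx Dn.
  apply: le_lt_trans (_ : (_ <= (q n)%:E)%E) _; last by rewrite lte_fin.
  by apply: ereal_inf_lbound; exists n.
(* Away from the observed vectors [r] may be infinite, and [fine] then returns zero. *)
exists (fun x => fine (r x)); split.
  move=> B mB.
  have mf : measurable_fun setT (fun x : TW => fine (r x)) by exact: measurableT_comp.
  by have := mTW _ (mf measurableT B mB); rewrite /SW/= setTI.
have /choice[N HN] : forall n, exists N, tau_null (m := m) Q F tau N /\
    forall w, ~ N w -> forall t, 0 <= t ->
      (Dplus `&` [set p | Y p < q n]) (t, w) <-> Dh n (observed t w, (t, w)).
  by move=> n; have [_ [N]] := HD n; exists N.
exists (\bigcup_n N n); first by apply: tau_null_bigcup => // n; have [] := HN n.
move=> w nN t t0.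
have H n : Y (t, w) < q n <-> Dh n (observed t w, (t, w)).
  have [_ /(_ w _ t t0)[|H1 H2]] := HN n; first by move=> Nn; apply: nN; exists n.
  by split=> [Yq|/H2[]//]; apply: H1.
suff -> : r (observed t w, (t, w)) = (Y (t, w))%:E by [].
apply/eqP; rewrite eq_le; apply/andP; split; last first.
  by apply: le_ereal_inf_tmp => _ [n /H Yq <-]; rewrite lee_fin ltW.
apply/lee_addgt0Pr => e e0.
have /rat_in_itvoo[x] : Y (t, w) < Y (t, w) + e by rewrite ltrDl.
rewrite in_itv/= => /andP[Yx xe].
have qx : q (pickle x) = ratr x by rewrite /q pickleK.
apply: le_trans (_ : (_ <= (q (pickle x))%:E)%E) _; last first.
  by rewrite qx -EFinD lee_fin ltW.
by apply: ereal_inf_lbound; exists (pickle x) => //=; apply/H; rewrite qx.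
Qed.

End splitting.

(** * Order statistics *)

Lemma sorted_nth_le (disp : Order.disp_t) (T : orderType disp) (x0 t : T) (s : seq T) i :
  sorted <=%O s -> (i < size s)%N ->
  (nth x0 s i <= t)%O = (i < count (<= t)%O s)%N.
Proof.
move=> ss is_; have [ic|ci] := ltnP i (count (<= t)%O s).
  exact: nth_count_le.
by apply/negbTE; rewrite -ltNge; apply: nth_count_gt => //; rewrite ci.
Qed.

Section order_statistics.
Context {d : measure_display} {Omega : measurableType d} {R : realType} {m : nat}.
Variables (tau : nat -> Omega -> \bar R) (w : Omega) (t : R).
Hypothesis t0 : 0 <= t.

Let s := sort (fun x y : \bar R => (x <= y)%E) [seq tau j w | j <- iota 0 m].
(** The number of times that have occurred by [t], hence the index of the only interval containing
    [t]. *)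
Let c := count (fun x => (x <= t%:E)%E) s.

Let ss : sorted <=%O s. Proof. exact: sort_le_sorted. Qed.
Let szs : size s = m. Proof. by rewrite /s size_sort size_map size_iota. Qed.
Let cm : (c <= m)%N. Proof. by rewrite -szs count_size. Qed.

Lemma sigma_os_le i : (i <= m)%N -> (sigma_os m tau i w <= t%:E)%E = (i <= c)%N.
Proof.
case: i => [|i] im; rewrite /sigma_os/=; first by rewrite lee_fin t0.
by rewrite ltnNge im/= -/s sorted_nth_le// szs.
Qed.

Lemma sigma_os_gt i : (i <= m)%N -> (t%:E < sigma_os m tau i.+1 w)%E = (c <= i)%N.
Proof.
move=> im; rewrite /sigma_os/= ltnS; case: leqP => [mi|lim].
  by rewrite ltry (leq_trans cm mi).
by rewrite -/s ltNge sorted_nth_le ?szs// -leqNgt.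
Qed.

(** The times up to [t] occupy the first [c] places of the sorted list, so they are exactly those
    not exceeding [sigma_os m tau c w]. *)
Lemma nmid_sigma_os (j : 'I_m) : nmid (tau j w) (sigma_os m tau c w) = nmid (tau j w) t%:E.
Proof.
rewrite /nmid; suff -> : (tau j w <= sigma_os m tau c w)%E = (tau j w <= t%:E)%E by [].
have sc : (sigma_os m tau c w <= t%:E)%E by rewrite sigma_os_le.
apply/idP/idP => [/le_trans|jt]; first exact.
have js : tau j w \in s.
  by rewrite /s mem_sort; apply/mapP; exists (nat_of_ord j) => //; rewrite mem_iota/=.
pose i := index (tau j w) s.
have iz : (i < size s)%N by rewrite index_mem.
have ni : nth 0%E s i = tau j w by rewrite nth_index.
have ic : (i < c)%N by rewrite -(sorted_nth_le 0%E)// ni.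
(* By [ic] the count is positive, so [sigma_os] reads the sorted list at index [c.-1]. *)
have [k ck] : exists k, c = k.+1 by case: (c) ic => // k; exists k.
rewrite ck /sigma_os/= -ck ltnNge cm/= -/s -ni.
apply: (sorted_leq_nth le_trans le_refl 0%E ss); rewrite ?inE ?szs.
- by rewrite -szs.
- by rewrite -ck.
- by rewrite -ltnS -ck.
Qed.

Lemma sum_order_statistics (f : @vec R m -> R) :
  \sum_(i < m.+1) f (fun j : 'I_m => nmid (tau j w) (sigma_os m tau i w)) *
    (if (sigma_os m tau i w <= t%:E)%E && (t%:E < sigma_os m tau i.+1 w)%E then 1 else 0) =
  f (fun j : 'I_m => nmid (tau j w) t%:E).
Proof.
have cm1 : (c < m.+1)%N by rewrite ltnS.
rewrite (bigD1 (Ordinal cm1))//= sigma_os_le// sigma_os_gt// leqnn mulr1 big1 => [|i ic].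
  by rewrite addr0; congr f; apply/funext => j; exact: nmid_sigma_os.
have im : (i <= m)%N by rewrite -ltnS.
rewrite -val_eqE/= in ic.
by rewrite sigma_os_le// sigma_os_gt// -eqn_leq (negbTE ic) mulr0.
Qed.

End order_statistics.

Theorem mainTheorem16 (d : measure_display) (Omega : measurableType d) (R : realType)
  (Q : probability Omega R) (F : R -> set (set Omega)) (m : nat)
  (tau : nat -> Omega -> \bar R) :
  (forall t, 0 <= t -> sigma_algebra setT (F t)) ->
  (forall t, 0 <= t -> F t `<=` measurable) ->
  (forall s t, 0 <= s -> s <= t -> F s `<=` F t) ->
  (forall t, 0 <= t -> F t = [set A | forall s, t < s -> F s A]) ->
  nullsig Q (Finfty F) `<=` F 0 ->
  (forall j, (j < m)%N -> measurable_fun setT (tau j)) ->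
  (forall j w, (j < m)%N -> (0 <= tau j w)%E) ->
  density_hyp Q F m tau ->
  optional_splitting Q F m tau.
Proof.
move=> FS Fm Fnd Frc _ mtau tau0 dens Y mY.
have [Yh [mYh [N nN YE]]] := optional_process_split FS Fm Fnd Frc mtau tau0 dens mY.
(* One function serves all intervals: on each of them the vector cut at [sigma_os] equals the vector
   observed at [t]. *)
exists (fun=> Yh); split=> //; exists N; split.
- exact: (tau_null_Nk Fm mtau nN).
- have [M [TM QM NM]] := nN; exists M; split=> //.
  exact: (tau_sig_measurable Fm mtau TM).
- move=> w Nw t t0; rewrite (YE w Nw t t0).
  by rewrite (sum_order_statistics tau w t0 (fun v => Yh (v, (t, w)))).
Qed.
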